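(* Let $(\pi:\mathcal{G}\to M,\theta)$ be a torsion-free $|1|$-graded parabolic geometry of type $(G,P)$, with associated almost para-Kähler structure $(h,\Omega)$ on $A=\mathcal{G}/G_0$, and let $\sigma:\mathcal{G}_0\to\mathcal{G}$ be a choice of Weyl structure, with Weyl connection $\vartheta_\sigma$, Rho tensor $\boldsymbol{\mathsf{P}}^\sigma$ and induced diffeomorphism $\varphi_\sigma:T^*M\to A$. Let $\nu:T^*M\to M$ be the projection and $h_{\vartheta_\sigma}$ the Patterson--Walker metric of $\vartheta_\sigma$. Then $$(\varphi_\sigma)^*h=h_{\vartheta_\sigma}-\nu^*(\operatorname{Sym}\boldsymbol{\mathsf{P}}^\sigma)+\boldsymbol{q},$$ where $\boldsymbol{q}$ is the tensor field on $T^*M$ (a one-form with values in $\nu^*T^*M$, viewed as a covariant $2$-tensor field) given, for $\alpha\in T^*M$ with $\nu(\alpha)=x$ and $X\in T_\alpha T^*M$, by $$\boldsymbol{q}(\alpha)(X)=\tfrac12\{\nu'_\alpha(X),\alpha\}(\alpha)\in T_x^*M=(\nu^*T^*M)_\alpha .$$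
   Context: All manifolds and maps are $C^\infty$. $\operatorname{Sym}$ and $\operatorname{Alt}$ denote the symmetric and alternating parts of a covariant 2-tensor: $\operatorname{Sym}b(X,Y)=\frac12(b(X,Y)+b(Y,X))$, $\operatorname{Alt}b(X,Y)=\frac12(b(X,Y)-b(Y,X))$. **Lie-theoretic data.** $G$ is a semisimple Lie group whose Lie algebra has a $|1|$-grading $\mathfrak g=\mathfrak g_{-1}\oplus\mathfrak g_0\oplus\mathfrak g_1$: $[\mathfrak g_i,\mathfrak g_j]\subset\mathfrak g_{i+j}$ (with $\mathfrak g_{\pm2}=0$) and no simple ideal of $\mathfrak g$ is contained in $\mathfrak g_0$. $P\subset G$ is a closed (parabolic) subgroup with Lie algebra $\mathfrak p=\mathfrak g_0\oplus\mathfrak g_1$. $G_0\subset P$ is the subgroup of those $g$ for which $\operatorname{Ad}(g)$ preserves the grading; its Lie algebra is $\mathfrak g_0$. The map $\exp$ restricts to a diffeomorphism from $\mathfrak g_1$ onto a closed normal subgroup $P_+\subset P$, $G_0\cong P/P_+$, and every $g\in P$ is uniquely $g_0\exp(Z)$ with $g_0\in G_0$, $Z\in\mathfrak g_1$. $B$ is a fixed nonzero constant multiple of the Killing form of $\mathfrak g$ (a suitable normalization), and $\psi_B:\mathfrak g_1\to\mathfrak g_{-1}^*$, $\psi_B(Z)(X)=B(Z,X)$, which is an isomorphism. **Parabolic geometry.** $\pi:\mathcal G\to M$ is a right principal $P$-bundle, $\dim M=n=\dim\mathfrak g_{-1}$, with a Cartan connection $\theta\in\Omega^1(\mathcal G,\mathfrak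 g)$: each $\theta_u:T_u\mathcal G\to\mathfrak g$ is an isomorphism, $R_g^*\theta=\operatorname{Ad}(g^{-1})\circ\theta$ for $g\in P$, and $\theta$ reproduces the generators of fundamental vector fields. The curvature is $\Theta=\mathrm d\theta+\frac12[\theta,\theta]$; torsion-free means $\Theta$ has values in $\mathfrak p$. The geometry is also assumed normal: writing $\Theta$ via $\theta$ as a function $\kappa:\mathcal G\to\Lambda^2(\mathfrak g/\mathfrak p)^*\otimes\mathfrak g$, one has $\sum_i[Z^i,\kappa(X_i,X)]=0$ for all $X\in\mathfrak g_{-1}$, where $(X_i)$, $(Z^i)$ are $B$-dual bases of $\mathfrak g_{-1}$ and $\mathfrak g_1$. Write $\theta=(\theta_{-1},\theta_0,\theta_1)$ according to the grading. **Underlying $G_0$-structure.** $\mathcal G_0=\mathcal G/P_+\to M$ is a principal $G_0$-bundle, and $\theta_{-1}$ descends to a soldering form $\omega\in\Omega^1(\mathcal G_0,\mathfrak g_{-1})$, which identifies $TM\cong\mathcal G_0\times_{G_0}\mathfrak g_{-1}$ (adjoint action). Hence $T^*M\cong\mathcal G_0\times_{G_0}\mathfrak g_{-1}^*\cong\mathcal G_0\times_{G_0}\mathfrak g_1$, the last identification via $\psi_B$. **Weyl structures.** A Weyl structure is a $G_0$-equivariant section $\sigma:\mathcal G_0\to\mathcal G$ of $\mathcal G\to\mathcal G_0$. One has $\sigma^*\theta_{-1}=\omega$; $\vartheta_\sigma=\sigma^*\theta_0\in\Omega^1(\mathcal G_0,\mathfrak g_0)$ is a principal connection, the Weyl connection;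 and $\mathsf P^\sigma=-\psi_B\circ(\sigma^*\theta_1)\in\Omega^1(\mathcal G_0,\mathfrak g_{-1}^* )$ is semibasic and equivariant and so represents a $T^*M$-valued one-form $\boldsymbol{\mathsf P}^\sigma$ on $M$, the Rho tensor, regarded as a $\binom02$-tensor field. The map $\Phi_\sigma:\mathcal G_0\times\mathfrak g_1\to\mathcal G$, $(y,Z)\mapsto\sigma(y)\cdot\exp(Z)$, is a $G_0$-equivariant diffeomorphism (for the $G_0$-action $(y,Z)\cdot g_0=(y\cdot g_0,\operatorname{Ad}(g_0^{-1})Z)$), and $\varphi_\sigma:T^*M\cong\mathcal G_0\times_{G_0}\mathfrak g_1\to\mathcal G/G_0=A$ is the induced diffeomorphism. **Almost para-Kähler structure on $A$.** Viewing $\theta$ as a Cartan connection on $\mathcal G\to A=\mathcal G/G_0$, one has $TA=\mathcal G\times_{G_0}(\mathfrak g/\mathfrak g_0)=L^+\oplus L^-$ with $L^\pm=\mathcal G\times_{G_0}\mathfrak g_{\pm1}$. The form $\eta=\psi_B\circ\theta_1\in\Omega^1(\mathcal G,\mathfrak g_{-1}^* )$ is $G_0$-equivariant and semibasic over $A$, so it represents a one-form $\boldsymbol\eta$ on $A$ with values in $(L^-)^*\subset T^*A$ (extended by zero on $L^+$), i.e. a section of $T^*A\otimes T^*A$. Then $h=\operatorname{Sym}\boldsymbol\eta$ and $\Omega=\operatorname{Alt}\boldsymbol\eta$. **Patterson--Walker metric.** Let $\xi:\mathcal G_0\times\mathfrak g_{-1}^*\to\mathfrak g_{-1}^*$ be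 the projection and $\varrho^*:\mathfrak g_0\to\mathfrak{gl}(\mathfrak g_{-1}^* )$ the dual of the adjoint representation on $\mathfrak g_{-1}$. The form $\zeta_{\vartheta_\sigma}=\mathrm d\xi+(\varrho^*\circ\vartheta_\sigma)(\xi)$ represents a one-form $\boldsymbol\zeta_{\vartheta_\sigma}$ on $T^*M$ with values in $\nu^*T^*M\subset T^*(T^*M)$, i.e. a section of $T^*(T^*M)\otimes T^*(T^*M)$, and $h_{\vartheta_\sigma}=\operatorname{Sym}\boldsymbol\zeta_{\vartheta_\sigma}$. **The operation $\{\cdot,\cdot\}$.** For $X\in T_xM$ and $\alpha\in T_x^*M$, $\{X,\alpha\}$ is the endomorphism of $T_xM$, respectively of $T^*_xM$, induced by the $G_0$-equivariant maps $(X_1,W_1)\mapsto(X_2\mapsto[[X_1,W_1],X_2])$, $X_2\in\mathfrak g_{-1}$, respectively $(X_1,W_1)\mapsto(W_2\mapsto[[X_1,W_1],W_2])$, $W_2\in\mathfrak g_1$ (where $X_1\in\mathfrak g_{-1}$, $W_1\in\mathfrak g_1$), using $TM\cong\mathcal G_0\times_{G_0}\mathfrak g_{-1}$ and $T^*M\cong\mathcal G_0\times_{G_0}\mathfrak g_1$. In the formula for $\boldsymbol q$ the version on $T^*M$ is used. $\nu'_\alpha$ is the derivative of $\nu$ at $\alpha$. *)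

(* Defs.v *)
(* Analysis is over an arbitrary [R : realType] of MathComp-Analysis; all
   manifolds are modelled on the normed spaces 'rV[R]_d (or products of these). *)
From HB Require Import structures.
From mathcomp Require Import all_boot all_order all_algebra.
From mathcomp Require Import all_classical all_reals all_analysis.

Set Implicit Arguments.
Unset Strict Implicit.
Unset Printing Implicit Defensive.

Import Order.TTheory GRing.Theory Num.Theory.
Import numFieldNormedType.Exports.

Local Open Scope classical_set_scope.
Local Open Scope ring_scope.

(** * Smooth manifolds *)

Section SmoothMaps.
Variables (R : realType) (E F : normedModType R).

(* C^r on an open set U.  On finite dimensional E, requiring all directional
   derivatives x |-> 'd f x v to be C^(r-1) is the usual condition. *)
Fixpoint Ck_on (r : nat) (U : set E) (f : E -> F) : Prop :=
  match r with
  | 0%N => forall x, U x -> {for x, continuous f}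
  | s.+1 => (forall x, U x -> differentiable f x) /\
            (forall v, Ck_on s U (fun x => 'd f x v))
  end.

Definition Cinf_on (U : set E) (f : E -> F) : Prop := forall r, Ck_on r U f.

End SmoothMaps.

(* [cmap] and [cinv] are total; only their values on [cdom] and [ccod] matter. *)
Record chart (M E : Type) := Chart {
  cdom : set M;
  ccod : set E;
  cmap : M -> E;
  cinv : E -> M
}.

(* A space with an atlas { chart_at p | p } that singles out one chart around
   each point.  As in Lean's Mathlib, the tangent space at p is the model space
   E, a vector being represented by its components in [chart_at p]. *)
Record charted (R : realType) (E : normedModType R) := Charted {
  csort :> topologicalType;
  chart_at : csort -> chart csort E
}.

Record is_chart (R : realType) (E : normedModType R) (M : topologicalType)
    (c : chart M E) : Prop := IsChart {
  chart_open_dom : open (cdom c);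
  chart_open_cod : open (ccod c);
  chart_map_cod : forall p, cdom c p -> ccod c (cmap c p);
  chart_inv_dom : forall e, ccod c e -> cdom c (cinv c e);
  chart_mapK : forall p, cdom c p -> cinv c (cmap c p) = p;
  chart_invK : forall e, ccod c e -> cmap c (cinv c e) = e;
  chart_map_cont : forall p, cdom c p -> {for p, continuous (cmap c)};
  chart_inv_cont : forall e, ccod c e -> {for e, continuous (cinv c)}
}.

Record is_manifold (R : realType) (E : normedModType R) (M : charted E) :
    Prop := IsManifold {
  mfd_hausdorff : hausdorff_space M;
  mfd_countable : @second_countable M;
  mfd_chart : forall p : M, is_chart (chart_at p);
  mfd_center : forall p : M, cdom (chart_at p) p;
  mfd_transition : forall p q : M,
    Cinf_on (ccod (chart_at p) `&` cinv (chart_at p) @^-1` cdom (chart_at q))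
            (cmap (chart_at q) \o cinv (chart_at p))
}.

Definition vspace_charted (R : realType) (E : normedModType R) : charted E :=
  @Charted R E E (fun=> Chart setT setT id id).

Definition prod_charted (R : realType) (E F : normedModType R)
    (M : charted E) (N : charted F) : charted (E * F)%type :=
  @Charted R (E * F)%type (M * N)%type (fun p =>
    Chart (cdom (chart_at p.1) `*` cdom (chart_at p.2))
          (ccod (chart_at p.1) `*` ccod (chart_at p.2))
          (fun q => (cmap (chart_at p.1) q.1, cmap (chart_at p.2) q.2))
          (fun e => (cinv (chart_at p.1) e.1, cinv (chart_at p.2) e.2))).

Section Maps.
Variables (R : realType) (E F : normedModType R).
Variables (M : charted E) (N : charted F).

(* U is meant to be open *)
Definition smooth_on (U : set M) (f : M -> N) : Prop :=
  (forall p, U p -> {for p, continuous f}) /\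
  (forall p q, Cinf_on
     [set e | [/\ ccod (chart_at p) e, U (cinv (chart_at p) e)
                & cdom (chart_at q) (f (cinv (chart_at p) e))]]
     (cmap (chart_at q) \o f \o cinv (chart_at p))).

Definition smooth (f : M -> N) : Prop := smooth_on setT f.

(* the tangent map T_pM -> T_(f p)N *)
Definition mderiv (f : M -> N) (p : M) : {linear E -> F} :=
  'd (cmap (chart_at (f p)) \o f \o cinv (chart_at p)) (cmap (chart_at p) p).

Definition closed_embedding (f : M -> N) : Prop :=
  [/\ smooth f, injective f, forall p, injective (mderiv f p),
      closed (range f) &
      forall U : set M, open U -> exists2 V : set N, open V & U = f @^-1` V].

End Maps.

Definition diffeo (R : realType) (E F : normedModType R)
    (M : charted E) (N : charted F) (f : M -> N) : Prop :=
  smooth f /\ exists g : N -> M, [/\ smooth g, cancel f g & cancel g f].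

Section Forms.
Variables (R : realType) (E W : normedModType R) (M : charted E).

(* W-valued one-forms on M *)
Definition form1 : Type := M -> E -> W.

(* local expression of a one-form in [chart_at p] *)
Definition form_coord (th : form1) (p : M) (x v : E) : W :=
  th (cinv (chart_at p) x)
     (mderiv (M := vspace_charted E) (N := M) (cinv (chart_at p)) x v).

Definition smooth_form (th : form1) : Prop :=
  forall p v, Cinf_on (ccod (chart_at p)) (fun x => form_coord th p x v).

(* convention: d th(V,W) = V(th W) - W(th V) - th [V,W] *)
Definition ext_deriv (th : form1) (p : M) (v w : E) : W :=
  'd (fun x => form_coord th p x w) (cmap (chart_at p) p) v -
  'd (fun x => form_coord th p x v) (cmap (chart_at p) p) w.

End Forms.

(** * Covariant 2-tensor fields *)

Definition tensor02 (R : realType) (E : normedModType R) (M : charted E) :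
  Type := M -> E -> E -> R.

Definition Sym (R : realType) (E : normedModType R) (M : charted E)
    (b : tensor02 M) : tensor02 M :=
  fun p v w => 2^-1 * (b p v w + b p w v).

Definition pullback (R : realType) (E F : normedModType R)
    (M : charted E) (N : charted F) (f : M -> N) (b : tensor02 N) :
    tensor02 M :=
  fun p v w => b (f p) (mderiv f p v) (mderiv f p w).

(** * The cotangent bundle *)

(* Covectors are columns, the value of [a] at the row [v] being [v *m a]. *)
Definition pairing (R : realType) (n : nat) (v : 'rV[R]_n) (a : 'cV[R]_n) : R :=
  (v *m a) 0 0.

Section Cotangent.
Variables (R : realType) (n : nat) (M : charted 'rV[R]_n).

(* The point (x, a) is the covector at x with components [a] in [chart_at x];
   the topology is the one of the bundle, not the product topology. *)
Definition cotangent_type : Type := (M * 'cV[R]_n)%type.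

HB.instance Definition _ := Choice.copy cotangent_type (M * 'cV[R]_n)%type.

(* Jacobian at p (acting on rows) from the chart at x to the chart at p *)
Definition cot_jac (x p : M) : 'M[R]_n :=
  lin1_mx ('d (cmap (chart_at p) \o cinv (chart_at x)) (cmap (chart_at x) p)).

Definition cot_chart (t : cotangent_type) :
    chart cotangent_type ('rV[R]_n * 'cV[R]_n)%type :=
  let c := chart_at t.1 in
  Chart [set s : cotangent_type | cdom c s.1]
        (ccod c `*` setT)
        (fun s => (cmap c s.1, cot_jac t.1 s.1 *m s.2))
        (fun z => (cinv c z.1, invmx (cot_jac t.1 (cinv c z.1)) *m z.2)).

Definition cot_open (W : set cotangent_type) : Prop :=
  forall (t : cotangent_type) (z : 'rV[R]_n * 'cV[R]_n),
    ccod (cot_chart t) z -> W (cinv (cot_chart t) z) ->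
    nbhs z (cinv (cot_chart t) @^-1` W).

Fact cot_openT : cot_open setT.
Proof. by move=> t z _ _; exact: filterT. Qed.

Fact cot_openI : setI_closed cot_open.
Proof.
move=> V W oV oW t z zc [Vz Wz].
by apply: filterI; [exact: oV | exact: oW].
Qed.

Fact cot_open_bigU (I : Type) (f : I -> set cotangent_type) :
  (forall i, cot_open (f i)) -> cot_open (\bigcup_i f i).
Proof.
move=> of_ t z zc [i _ fiz].
by apply: filterS (of_ i t z zc fiz) => y fy; exists i.
Qed.

HB.instance Definition _ := isOpenTopological.Build cotangent_type
  cot_openT cot_openI cot_open_bigU.

Definition cotangent : charted ('rV[R]_n * 'cV[R]_n)%type :=
  @Charted R _ cotangent_type cot_chart.

Definition cot_proj : cotangent -> M := fst.

Definition covec : cotangent -> 'cV[R]_n := snd.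

End Cotangent.

(** * Lie groups *)

Record lieGroup (R : realType) (d : nat) := LieGroup {
  lg_car :> charted 'rV[R]_d;
  lg_mfd : is_manifold lg_car;
  lg_one : lg_car;
  lg_mul : lg_car -> lg_car -> lg_car;
  lg_inv : lg_car -> lg_car;
  lg_mulA : forall x y z, lg_mul x (lg_mul y z) = lg_mul (lg_mul x y) z;
  lg_mul1g : forall x, lg_mul lg_one x = x;
  lg_mulg1 : forall x, lg_mul x lg_one = x;
  lg_mulVg : forall x, lg_mul (lg_inv x) x = lg_one;
  lg_mulgV : forall x, lg_mul x (lg_inv x) = lg_one;
  lg_mul_smooth : smooth (M := prod_charted lg_car lg_car) (N := lg_car)
                         (fun xy => lg_mul xy.1 xy.2);
  lg_inv_smooth : smooth lg_inv
}.
Arguments lg_one {R d} l.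

Section LieGroupTheory.
Variables (R : realType) (d : nat) (G : lieGroup R d).

(* The Lie algebra is T_1 G = 'rV[R]_d. *)
Definition Ad (g : G) : {linear 'rV[R]_d -> 'rV[R]_d} :=
  mderiv (fun x : G => lg_mul (lg_mul g x) (lg_inv g)) (lg_one G).

(* [X, Y] = ad X Y, with ad the derivative of Ad at 1; this is the bracket of
   left invariant vector fields. *)
Definition lie_br (X Y : 'rV[R]_d) : 'rV[R]_d :=
  mderiv (M := G) (N := vspace_charted 'rV[R]_d)
         (fun g : G => Ad g Y) (lg_one G) X.

(* g = exp X *)
Definition is_exp (X : 'rV[R]_d) (g : G) : Prop :=
  exists c : vspace_charted R -> G,
    [/\ smooth c, forall s t, c (s + t) = lg_mul (c s) (c t),
        mderiv c 0 1 = X & c 1 = g].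

End LieGroupTheory.

Definition lie_subgroup (R : realType) (d e : nat) (H : lieGroup R d)
    (G : lieGroup R e) (i : H -> G) : Prop :=
  (forall x y, i (lg_mul x y) = lg_mul (i x) (i y)) /\ closed_embedding i.

Section LieAlgebra.
Variables (R : realType) (N : nat) (br : 'rV[R]_N -> 'rV[R]_N -> 'rV[R]_N).
Implicit Types a b : {vspace 'rV[R]_N}.

Definition lie_ideal a : Prop := forall x y, y \in a -> br x y \in a.

Definition lie_derived a : {vspace 'rV[R]_N} :=
  <<[seq br x y | x <- vbasis a, y <- vbasis a]>>%VS.

Definition lie_solvable a : Prop := exists r, iter r lie_derived a = 0%VS.

Definition lie_semisimple : Prop :=
  forall a, lie_ideal a -> lie_solvable a -> a = 0%VS.

Definition simple_ideal a : Prop :=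
  [/\ lie_ideal a,
      exists x y, [/\ x \in a, y \in a & br x y != 0] &
      forall b, (b <= a)%VS ->
        (forall x y, x \in a -> y \in b -> br x y \in b) ->
        b = 0%VS \/ b = a].

Definition killing (x y : 'rV[R]_N) : R :=
  \tr (lin1_mx (br x) *m lin1_mx (br y)).

End LieAlgebra.

(** * |1|-gradings and parabolic subgroups *)

(* A direct sum decomposition of 'rV_N into three summands, identified with
   'rV_n, 'rV_m, 'rV_k by bases; the matrices (acting on rows) are the
   inclusions of the summands and the projections onto them. *)
Record decomposition (R : realType) (N n m k : nat) := Decomposition {
  in_m1 : 'M[R]_(n, N);
  in_0 : 'M[R]_(m, N);
  in_1 : 'M[R]_(k, N);
  pr_m1 : 'M[R]_(N, n);
  pr_0 : 'M[R]_(N, m);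
  pr_1 : 'M[R]_(N, k);
  dec_inK : col_mx (col_mx in_m1 in_0) in_1 *m
            row_mx (row_mx pr_m1 pr_0) pr_1 = 1%:M;
  dec_prK : pr_m1 *m in_m1 + pr_0 *m in_0 + pr_1 *m in_1 = 1%:M
}.

Definition gcomp (R : realType) (N n m k : nat)
    (D : decomposition R N n m k) (i : int) : set 'rV[R]_N :=
  if i == -1 then range (fun X : 'rV[R]_n => X *m in_m1 D)
  else if i == 0 then range (fun A : 'rV[R]_m => A *m in_0 D)
  else if i == 1 then range (fun Z : 'rV[R]_k => Z *m in_1 D)
  else [set 0].

(* B(Z, X) for Z in g_1, X in g_(-1), as a covector on g_(-1) *)
Definition psi (R : realType) (N n m k : nat) (D : decomposition R N n m k)
    (B : 'rV[R]_N -> 'rV[R]_N -> R) (Z : 'rV[R]_k) : 'cV[R]_n :=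
  \col_i B (Z *m in_1 D) (delta_mx 0 i *m in_m1 D).

(* Lie-theoretic data.  The subgroups P of G and G_0 of P are Lie groups with
   closed embeddings; [pd_exp] is exp restricted to g_1, as a map into P. *)
Record parabolicData (R : realType) (N n m k : nat) := ParabolicData {
  pd_G : lieGroup R N;
  pd_gr : decomposition R N n m k;
  pd_semisimple : lie_semisimple (lie_br pd_G);
  pd_graded : forall (i j : int) X Y, gcomp pd_gr i X -> gcomp pd_gr j Y ->
    gcomp pd_gr (i + j) (lie_br pd_G X Y);
  pd_effective : forall a : {vspace 'rV[R]_N},
    simple_ideal (lie_br pd_G) a ->
    ~ (forall X, X \in a -> gcomp pd_gr 0 X);

  pd_P : lieGroup R (m + k);
  pd_i : pd_P -> pd_G;
  pd_i_sub : lie_subgroup pd_i;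
  pd_P_alg : range (mderiv pd_i (lg_one pd_P)) =
    [set X + Y | X in gcomp pd_gr 0 & Y in gcomp pd_gr 1];

  pd_G0 : lieGroup R m;
  pd_j : pd_G0 -> pd_P;
  pd_j_sub : lie_subgroup pd_j;
  pd_G0_def : range pd_j =
    [set p | forall i X, gcomp pd_gr i X -> gcomp pd_gr i (Ad (pd_i p) X)];
  pd_G0_alg : range (mderiv (pd_i \o pd_j) (lg_one pd_G0)) = gcomp pd_gr 0;

  pd_exp : vspace_charted 'rV[R]_k -> pd_P;
  pd_expE : forall Z : 'rV[R]_k, is_exp (Z *m in_1 pd_gr) (pd_i (pd_exp Z));
  pd_exp_emb : closed_embedding pd_exp;
  pd_Pplus_mul : forall Z W, range pd_exp (lg_mul (pd_exp Z) (pd_exp W));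
  pd_Pplus_inv : forall Z, range pd_exp (lg_inv (pd_exp Z));
  pd_Pplus_normal : forall p Z,
    range pd_exp (lg_mul (lg_mul p (pd_exp Z)) (lg_inv p));
  pd_factor : forall p : pd_P, exists! gZ : pd_G0 * 'rV[R]_k,
    p = lg_mul (pd_j gZ.1) (pd_exp gZ.2);

  pd_c : R;
  pd_c_neq0 : pd_c != 0;
  pd_B := fun X Y => pd_c * killing (lie_br pd_G) X Y;
  pd_psi_bij : bijective (psi pd_gr pd_B)
}.

Section ParabolicNotions.
Variables (R : realType) (N n m k : nat) (D : parabolicData R N n m k).

Definition pd_br : 'rV[R]_N -> 'rV[R]_N -> 'rV[R]_N := lie_br (pd_G D).

(* psi_B : g_1 -> g_(-1)^* *)
Definition psiB (Z : 'rV[R]_k) : 'cV[R]_n := psi (pd_gr D) (@pd_B _ _ _ _ _ D) Z.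

(* the dual, on g_(-1)^*, of the adjoint representation of g_0 on g_(-1) *)
Definition rho_dual (A : 'rV[R]_m) (xi : 'cV[R]_n) : 'cV[R]_n :=
  - (lin1_mx (fun X : 'rV[R]_n =>
       pd_br (A *m in_0 (pd_gr D)) (X *m in_m1 (pd_gr D)) *m pr_m1 (pd_gr D))
     *m xi).

(* [[X, W1], W2] for X in g_(-1) and W1, W2 in g_1 *)
Definition triple_br (X : 'rV[R]_n) (W1 W2 : 'rV[R]_k) : 'rV[R]_k :=
  pd_br (pd_br (X *m in_m1 (pd_gr D)) (W1 *m in_1 (pd_gr D)))
        (W2 *m in_1 (pd_gr D)) *m pr_1 (pd_gr D).

End ParabolicNotions.

(** * Parabolic geometries *)

(* Right principal H-bundle.  The local trivialization over U is
   u |-> (pi u, tau u), with inverse [triv]. *)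
Record principal_bundle (R : realType) (E F : normedModType R) (d : nat)
    (H : lieGroup R d) (T : charted E) (X : charted F)
    (act : T -> H -> T) (pi : T -> X) : Prop := PrincipalBundle {
  pb_proj_smooth : smooth pi;
  pb_act_smooth : smooth (M := prod_charted T H) (N := T)
                         (fun uh => act uh.1 uh.2);
  pb_act1 : forall u, act u (lg_one H) = u;
  pb_actM : forall u g h, act u (lg_mul g h) = act (act u g) h;
  pb_proj_act : forall u h, pi (act u h) = pi u;
  pb_trivial : forall x : X, exists (U : set X) (tau : T -> H)
      (triv : prod_charted X H -> T),
    [/\ open U /\ U x,
        smooth_on (pi @^-1` U) tau /\
        smooth_on (M := prod_charted X H) [set xh | U xh.1] triv,
        forall u h, U (pi u) -> tau (act u h) = lg_mul (tau u) h,
        forall u, U (pi u) -> triv (pi u, tau u) = u &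
        forall y h, U y -> pi (triv (y, h)) = y /\ tau (triv (y, h)) = h]
}.

(* (pi : G -> M, theta) *)
Record cartanGeometry (R : realType) (N n m k : nat)
    (D : parabolicData R N n m k) (M : charted 'rV[R]_n) := CartanGeometry {
  cg_T : charted 'rV[R]_N;
  cg_mfd : is_manifold cg_T;
  cg_pi : cg_T -> M;
  cg_act : cg_T -> pd_P D -> cg_T;
  cg_bundle : principal_bundle cg_act cg_pi;
  cg_theta : form1 'rV[R]_N cg_T;
  cg_smooth : smooth_form cg_theta;
  cg_linear : forall u, linear (cg_theta u);
  cg_bij : forall u, bijective (cg_theta u);
  cg_equiv : forall u p V,
    cg_theta (cg_act u p) (mderiv (cg_act^~ p) u V) =
    Ad (pd_i (lg_inv p)) (cg_theta u V);
  cg_fund : forall u Y,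
    cg_theta u (mderiv (cg_act u) (lg_one (pd_P D)) Y) =
    mderiv (@pd_i _ _ _ _ _ D) (lg_one (pd_P D)) Y
}.

Section CartanNotions.
Variables (R : realType) (N n m k : nat) (D : parabolicData R N n m k).
Variables (M : charted 'rV[R]_n) (S : cartanGeometry D M).

Definition curvature (u : cg_T S) (V W : 'rV[R]_N) : 'rV[R]_N :=
  ext_deriv (cg_theta (c := S)) u V W + pd_br D (cg_theta u V) (cg_theta u W).

Definition torsion_free : Prop :=
  forall u V W, curvature u V W *m pr_m1 (pd_gr D) = 0.

(* the curvature function: X, Y in g_(-1) represent elements of g/p *)
Definition kappa (u : cg_T S) (X Y : 'rV[R]_n) : 'rV[R]_N :=
  let lift X := get [set V | cg_theta u V = X *m in_m1 (pd_gr D)] in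
  curvature u (lift X) (lift Y).

Definition normal : Prop :=
  forall (X : n.-tuple 'rV[R]_n) (Z : n.-tuple 'rV[R]_k),
    basis_of fullv X -> basis_of fullv Z ->
    (forall i j, pairing (tnth X i) (psiB D (tnth Z j)) = (i == j)%:R) ->
    forall u Y,
      \sum_i pd_br D (tnth Z i *m in_1 (pd_gr D)) (kappa u (tnth X i) Y) = 0.

(* the graded components of theta *)
Definition theta_m1 : form1 'rV[R]_n (cg_T S) :=
  fun u V => cg_theta u V *m pr_m1 (pd_gr D).
Definition theta_0 : form1 'rV[R]_m (cg_T S) :=
  fun u V => cg_theta u V *m pr_0 (pd_gr D).
Definition theta_1 : form1 'rV[R]_k (cg_T S) :=
  fun u V => cg_theta u V *m pr_1 (pd_gr D).

Definition act_G0 (u : cg_T S) (g : pd_G0 D) : cg_T S := cg_act u (pd_j g).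

End CartanNotions.

(* The quotient G_0-bundle G/P_+ -> M with its soldering form. *)
Record g0Structure (R : realType) (N n m k : nat)
    (D : parabolicData R N n m k) (M : charted 'rV[R]_n)
    (S : cartanGeometry D M) := G0Structure {
  s0_T : charted 'rV[R]_(n + m);
  s0_mfd : is_manifold s0_T;
  s0_q : cg_T S -> s0_T;
  s0_q_smooth : smooth s0_q;
  s0_q_subm : forall u v, exists V, mderiv s0_q u V = v;
  s0_q_surj : forall y, exists u, s0_q u = y;
  s0_q_fib : forall u w,
    s0_q u = s0_q w <-> exists Z, w = cg_act u (pd_exp D Z);
  s0_pi : s0_T -> M;
  s0_act : s0_T -> pd_G0 D -> s0_T;
  s0_bundle : principal_bundle s0_act s0_pi;
  s0_pi_q : forall u, s0_pi (s0_q u) = cg_pi u;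
  s0_act_q : forall u g, s0_act (s0_q u) g = s0_q (act_G0 u g);
  s0_omega : form1 'rV[R]_n s0_T;
  s0_omegaE : forall u V, s0_omega (s0_q u) (mderiv s0_q u V) = theta_m1 u V
}.

Section Objects.
Variables (R : realType) (N n m k : nat) (D : parabolicData R N n m k).
Variables (M : charted 'rV[R]_n) (S : cartanGeometry D M) (S0 : g0Structure S).

Local Notation calG := (cg_T S).
Local Notation calG0 := (s0_T S0).
Local Notation omega := (@s0_omega _ _ _ _ _ _ _ _ S0).
Local Notation pi0 := (@s0_pi _ _ _ _ _ _ _ _ S0).

(* The manifold A = G/G_0. *)
Definition is_quotient_G0 (A : charted 'rV[R]_(n + k)) (qA : calG -> A) : Prop :=
  is_manifold A /\ principal_bundle (H := pd_G0 D) (act_G0 (S := S)) qA.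

(* [cls] is the map (y, xi) |-> [y, xi] from G_0 x g_(-1)^* onto
   G_0 x_(G_0) g_(-1)^* = T^*M dual to the identification of TM given by the
   soldering form, in which T pi0 v corresponds to [y, omega v]. *)
Definition cotangent_identification
    (cls : prod_charted calG0 (vspace_charted 'cV[R]_n) -> cotangent M) : Prop :=
  smooth cls /\
  forall y xi, cot_proj (cls (y, xi)) = pi0 y /\
    forall v, pairing (mderiv pi0 y v) (covec (cls (y, xi))) =
              pairing (omega y v) xi.

(* The tensor field on A represented by eta = psi_B o theta_1: the value of the
   one-form at V is the covector that pairs psi_B(theta_1 V) with the
   L^- component, represented by theta_(-1) W, and vanishes on L^+. *)
Definition represents_eta (A : charted 'rV[R]_(n + k)) (qA : calG -> A)
    (eta : tensor02 A) : Prop :=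
  forall u V W, pullback qA eta u V W =
    pairing (theta_m1 (S := S) u W) (psiB D (theta_1 (S := S) u V)).

Definition weyl_structure (sigma : calG0 -> calG) : Prop :=
  [/\ smooth sigma, forall y, s0_q S0 (sigma y) = y &
      forall y g, sigma (s0_act y g) = act_G0 (sigma y) g].

Section Weyl.
Variables (sigma : calG0 -> calG).
Variables (cls : prod_charted calG0 (vspace_charted 'cV[R]_n) -> cotangent M).

Definition weyl_connection : form1 'rV[R]_m calG0 :=
  fun y v => theta_0 (sigma y) (mderiv sigma y v).

Definition rho_form : form1 'cV[R]_n calG0 :=
  fun y v => - psiB D (theta_1 (sigma y) (mderiv sigma y v)).

(* the tensor field on M represented by [rho_form] *)
Definition is_rho_tensor (rho : tensor02 M) : Prop :=
  forall y v w, pullback pi0 rho y v w = pairing (omega y w) (rho_form y v).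

(* the diffeomorphism [y, psi_B Z] |-> class of sigma(y).exp(Z) *)
Definition is_weyl_diffeo (A : charted 'rV[R]_(n + k)) (qA : calG -> A)
    (phi : cotangent M -> A) : Prop :=
  diffeo phi /\
  forall y Z, phi (cls (y, psiB D Z)) = qA (cg_act (sigma y) (pd_exp D Z)).

(* d xi + rho^*(vartheta)(xi) for a principal connection vartheta *)
Definition zeta_form (vartheta : form1 'rV[R]_m calG0) :
    form1 'cV[R]_n (prod_charted calG0 (vspace_charted 'cV[R]_n)) :=
  fun yxi v => v.2 + rho_dual D (vartheta yxi.1 v.1) yxi.2.

(* The tensor field on T^*M represented by [zeta_form].  The values of the
   one-form lie in nu^*T^*M, so they are paired with the image in TM of the
   second argument, which corresponds to omega. *)
Definition represents_zeta (vartheta : form1 'rV[R]_m calG0)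
    (zeta : tensor02 (cotangent M)) : Prop :=
  forall yxi v w, pullback cls zeta yxi v w =
    pairing (omega yxi.1 w.1) (zeta_form vartheta yxi v).

(* {X, alpha} on T^*_xM *)
Definition is_curly
    (curly : forall x : M, 'rV[R]_n -> 'cV[R]_n -> 'cV[R]_n -> 'cV[R]_n) : Prop :=
  forall y v W1 W2,
    curly (pi0 y) (mderiv pi0 y v)
          (covec (cls (y, psiB D W1))) (covec (cls (y, psiB D W2))) =
    covec (cls (y, psiB D (triple_br D (omega y v) W1 W2))).

End Weyl.

Definition q_tensor
    (curly : forall x : M, 'rV[R]_n -> 'cV[R]_n -> 'cV[R]_n -> 'cV[R]_n) :
    tensor02 (cotangent M) :=
  fun al X Y =>
    let x := cot_proj al in
    let dnu := mderiv (@cot_proj R n M) al in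
    pairing (dnu Y) (2^-1 *: curly x (dnu X) (covec al) (covec al)).

End Objects.

(* Main.v *)
(* The map (y, Z) |-> phi [y, psi_B Z] is the projection to A of
   Psi (y, Z) = sigma(y) exp(Z).  By equivariance of the Cartan connection and
   since g_1 is abelian, Psi^* theta = Ad(exp(-Z)) (sigma^* theta) + dZ, and
   Ad(exp(-Z)) = 1 - ad Z + (ad Z)^2 / 2 because (ad Z)^3 = 0.  Hence
   psi_B o theta_1 pulls back to
     d xi + rho^*(vartheta) xi - P + 1/2 {omega, xi} xi,    xi = psi_B Z,
   where invariance of the Killing form turns - psi_B [Z, vartheta] into
   rho^*(vartheta) xi.  As [y, xi] is a surjective submersion onto T^*M, this
   determines the pullback of eta, and symmetrizing gives the formula: the last
   term is already symmetric, being - 1/2 B([Z, X], [Z, Y]). *)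
Require Import Defs.
From HB Require Import structures.
From mathcomp Require Import all_boot all_order all_algebra.
From mathcomp Require Import ring.
From mathcomp Require Import all_classical all_reals all_analysis.
Import Order.TTheory GRing.Theory Num.Theory.
Import numFieldNormedType.Exports.
Local Open Scope classical_set_scope.
Local Open Scope ring_scope.

Set Implicit Arguments.
Unset Strict Implicit.
Unset Printing Implicit Defensive.

(** * Calculus *)

(** Two features of the setting shape the work. Tangent vectors are components in a chart that
    changes with the point, and [mderiv] is a total function, so no tangent map can be manipulated
    before differentiability is established. Derivatives are therefore carried by the relation
    [has_mderiv], and identities between tangent maps come from computing the derivative of one map
    along two factorizations and comparing with [has_mderiv_uniq]. The Lie algebra also has to be
    recovered from the group: the bracket is a derivative of [Ad], and the exponential of [g_1] is
    given only pointwise, each value lying on some one-parameter subgroup. Differentiating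
    identities satisfied by [Ad] gives the algebra, while uniqueness of one-parameter subgroups
    gives additivity of the exponential on [g_1] and its derivative at 0. The series for [Ad] of an
    exponential is not summed: a polynomial is guessed and its difference with [Ad] is shown to have
    zero derivative. *)

Lemma continuous_near_eq (T U : topologicalType) (f g : T -> U) (x : T) :
  {near x, f =1 g} -> {for x, continuous f} -> {for x, continuous g}.
Proof.
move=> fg fc; rewrite /prop_for /continuous_at -(nbhs_singleton fg).
by apply: cvg_trans fc; exact: near_eq_cvg.
Qed.

Section Calculus.
Variable R : realType.

(** The difference [g - f] vanishes near [x], so it has differential zero, and adding it to [f]
    carries the derivative over. Needed because charts cancel their inverses only locally. *)
Lemma is_diff_near_eq (V W : normedModType R) (f g df : V -> W) (x : V) :
  {near x, f =1 g} -> is_diff x f df -> is_diff x g df.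
Proof.
move=> fg dfx.
have fg0 : \forall k \near (0 : V), f (k + x) = g (k + x).
  by move: (fg); rewrite (near_shift 0 x) subr0.
have d0 : is_diff x (g - f) (0 : V -> W).
  have e : continuous (0 : V -> W) /\
      (g - f) \o shift x = cst ((g - f) x) + (0 : V -> W) +o_ 0 id.
    split; first by move=> ?; exact: cst_continuous.
    apply/eqaddoE; rewrite funeqE => h; rewrite /= -[RHS]/(_ + _ + _).
    have -> : (g - f) x = 0.
      by rewrite -[LHS]/(g x - f x) (nbhs_singleton fg) subrr.
    rewrite add0r [(0 : V -> W) h](_ : _ = 0) // add0r.
    rewrite -[LHS]/(((g - f) \o shift x) h).
    suff -> : (g - f) \o shift x =o_ (0 : V) id by [].
    apply/eqoP => _/posnumP[e]; apply: filterS fg0 => k fgk.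
    rewrite [X in `|X|](_ : _ = 0) ?normr0 ?mulr_ge0 //.
    by rewrite -[LHS]/(g (k + x) - f (k + x)) fgk subrr.
  pose z : {linear V -> W} := \0.
  have dz : 'd (g - f) x = z :> (V -> W) by apply: diff_unique; case: e.
  split; last by rewrite dz.
  by apply/diff_locallyP; rewrite dz; exact: e.
have -> : g = f + (g - f) by rewrite addrC subrK.
by apply: (is_diff_eq (is_diffD dfx d0)); rewrite addr0.
Qed.

Lemma is_diff_uniq (V W : normedModType R) (f g df dg : V -> W) (x : V) :
  is_diff x f df -> is_diff x g dg -> f =1 g -> df =1 dg.
Proof.
move=> fd gd /funext fg v; rewrite fg in fd.
by rewrite -(diff_val (is_diff_def := fd)) (diff_val (is_diff_def := gd)).
Qed.

Lemma is_diff_sum (V W : normedModType R) (I : Type) (r : seq I)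
    (f df : I -> V -> W) (x : V) :
  (forall i, is_diff x (f i) (df i)) ->
  is_diff x (fun y => \sum_(i <- r) f i y) (fun y => \sum_(i <- r) df i y).
Proof.
move=> h; elim: r => [|i r IH].
  under [X in is_diff _ X]eq_fun do rewrite big_nil.
  under [X in is_diff _ _ X]eq_fun do rewrite big_nil.
  exact: is_diff_cst.
under [X in is_diff _ X]eq_fun do rewrite big_cons.
under [X in is_diff _ _ X]eq_fun do rewrite big_cons.
exact: is_diffD.
Qed.

Lemma is_diff_coord (V : normedModType R) m n (f df : V -> 'M[R]_(m, n)) x i j :
  is_diff x f df -> is_diff x (fun y => f y i j) (fun y => df y i j).
Proof.
pose c : 'M[R]_(m, n) -> R := fun N => N i j.
have c_lin : linear c by move=> a u v; rewrite /c !mxE.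
pose cL : {linear 'M[R]_(m, n) -> R} :=
  HB.pack c (GRing.isLinear.Build _ _ _ _ _ c_lin).
have dc y : is_diff y cL cL.
  split; last by apply: diff_lin; exact: coord_continuous.
  exact: differentiable_coord.
by move=> df_; exact: is_diff_comp df_ (dc _).
Qed.

Lemma matrixE_sum m n (A : 'M[R]_(m, n)) :
  A = \sum_(p : 'I_m * 'I_n) A p.1 p.2 *: delta_mx p.1 p.2.
Proof. by rewrite {1}[A]matrix_sum_delta pair_big. Qed.

Lemma is_diff_scale (V W : normedModType R) (a da : V -> R) (f df : V -> W) x :
  is_diff x a da -> is_diff x f df ->
  is_diff x (fun y => a y *: f y) (fun y => a x *: df y + da y *: f x).
Proof.
move=> ad fd; pose b : R -> W -> W := fun c w => c *: w.
have b_bilin : bilinear_for (GRing.Scale.Law.clone _ _ *:%R _)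
    (GRing.Scale.Law.clone _ _ *:%R _) b.
  split=> [w|c] l u v; rewrite /b /=; first by rewrite scalerDl scalerA.
  by rewrite scalerDr !scalerA mulrC.
pose bB : {bilinear R -> W -> W} :=
  HB.pack b (bilinear_isBilinear.Build R R W W _ _ b b_bilin).
have bc : continuous (fun p => bB p.1 p.2) by move=> p; exact: scale_continuous.
have db p : is_diff p (fun q => bB q.1 q.2) (fun q => bB p.1 q.2 + bB q.1 p.2).
  by split; [exact: differentiable_bilin | exact: diff_bilin].
exact: (is_diff_comp (is_diff_pair ad fd) (db (a x, f x))).
Qed.

(** Continuity is automatic in finite dimension: the map is a finite sum of coordinates times
    constant vectors. *)
Lemma is_diff_linear_mx (W : normedModType R) m n (f : 'M[R]_(m, n) -> W) x :
  linear f -> is_diff x f f.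
Proof.
move=> f_lin.
pose fL : {linear 'M[R]_(m, n) -> W} :=
  HB.pack f (GRing.isLinear.Build _ _ _ _ _ f_lin).
have fE y : f y = \sum_(p : 'I_m * 'I_n) y p.1 p.2 *: f (delta_mx p.1 p.2).
  rewrite -[f]/(fL : _ -> _) {1}[y]matrixE_sum linear_sum.
  by apply: eq_bigr => p _; rewrite linearZ.
rewrite (funext fE : f = _).
apply: is_diff_sum => p.
have h : is_diff x (fun y : 'M[R]_(m, n) => y p.1 p.2) (fun y => y p.1 p.2).
  exact: is_diff_coord (is_diff_id x).
apply: is_diff_eq (is_diff_scale h (is_diff_cst (f (delta_mx p.1 p.2)) x)) _.
by apply/funext => y /=; rewrite scaler0 add0r.
Qed.

Lemma is_diff_mx (V : normedModType R) m n (f df : V -> 'M[R]_(m, n)) x :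
  (forall i j, is_diff x (fun y => f y i j) (fun y => df y i j)) ->
  is_diff x f df.
Proof.
move=> h.
rewrite (funext (fun y => matrixE_sum (f y)) : f = _).
rewrite (funext (fun y => matrixE_sum (df y)) : df = _).
apply: is_diff_sum => p.
apply: is_diff_eq (is_diff_scale (h p.1 p.2)
  (is_diff_cst (delta_mx p.1 p.2 : 'M[R]_(m, n)) x)) _.
by apply/funext => y /=; rewrite scaler0 add0r.
Qed.

Lemma is_diff_mulmx (V : normedModType R) m n p (f df : V -> 'M[R]_(m, n))
    (g dg : V -> 'M[R]_(n, p)) x :
  is_diff x f df -> is_diff x g dg ->
  is_diff x (fun y => f y *m g y) (fun y => f x *m dg y + df y *m g x).
Proof.
move=> fd gd; apply: is_diff_mx => i j.
under [X in is_diff _ X]eq_fun do rewrite mxE.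
under [X in is_diff _ _ X]eq_fun do rewrite !mxE -big_split /=.
apply: is_diff_sum => k.
exact: (is_diff_scale (is_diff_coord i k fd) (is_diff_coord k j gd)).
Qed.

(** Smoothness in the sense of [Ck_on] controls [x |-> 'd f x v] only for fixed [v]. Expanding the
    argument in the standard basis allows [v] to move with the point. *)
Lemma differentiable_apply_linear (U W : normedModType R) d
    (L : U -> 'rV[R]_d -> W) (w : U -> 'rV[R]_d) (x : U) :
  (forall y, linear (L y)) -> (forall v, differentiable (L^~ v) x) ->
  differentiable w x -> differentiable (fun y => L y (w y)) x.
Proof.
move=> L_lin Ld wd.
have LE y v :
    L y v = \sum_(p : 'I_1 * 'I_d) v p.1 p.2 *: L y (delta_mx p.1 p.2).
  pose lL : {linear 'rV[R]_d -> W} :=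
    HB.pack (L y) (GRing.isLinear.Build _ _ _ _ _ (L_lin y)).
  rewrite -[L y]/(lL : _ -> _) {1}[v]matrixE_sum linear_sum.
  by apply: eq_bigr => p _; rewrite linearZ.
rewrite (funext (fun y => LE y (w y))).
have h p := is_diff_scale (is_diff_coord p.1 p.2 (differentiableP wd))
  (differentiableP (Ld (delta_mx p.1 p.2))).
by case: (is_diff_sum (index_enum ('I_1 * 'I_d)%type) h).
Qed.

Lemma is_diff_fst (V W : normedModType R) (z : V * W) :
  is_diff z (fst : V * W -> V) fst.
Proof.
have c : continuous (fst : V * W -> V) by move=> ?; exact: cvg_fst.
pose l : {linear (V * W)%type -> V} := fst.
by split; [exact: (linear_differentiable (f := l)) |
           exact: (diff_lin (f := l))].
Qed.

Lemma is_diff_snd (V W : normedModType R) (z : V * W) :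
  is_diff z (snd : V * W -> W) snd.
Proof.
have c : continuous (snd : V * W -> W) by move=> ?; exact: cvg_snd.
pose l : {linear (V * W)%type -> W} := snd.
by split; [exact: (linear_differentiable (f := l)) |
           exact: (diff_lin (f := l))].
Qed.

Lemma is_diff_scalev (V : normedModType R) (v : V) (t : R) :
  is_diff t (fun s : R => s *: v) (fun s => s *: v).
Proof.
apply: is_diff_eq (is_diff_scale (is_diff_id t) (is_diff_cst v t)) _.
by apply/funext => s /=; rewrite scaler0 add0r.
Qed.

Lemma is_diff_subr (V : normedModType R) (a z : V) :
  is_diff z (fun u => u - a) id.
Proof.
apply: is_diff_eq (is_diffB (is_diff_id z) (is_diff_cst a z)) _.
by apply/funext => v; rewrite -[LHS]/(v - 0) subr0.
Qed.

End Calculus.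

(** * Tangent maps *)

Section Derivatives.
Variable R : realType.

(** Continuity is a separate clause: the local expression uses the total function [cmap], so its
    differentiability does not keep [f] inside the chart domain around [f p], as the chain rule
    requires. *)
Definition has_mderiv (E F : normedModType R) (M : charted E) (N : charted F)
    (f : M -> N) (p : M) (df : E -> F) : Prop :=
  {for p, continuous f} /\
  is_diff (cmap (chart_at p) p)
          (cmap (chart_at (f p)) \o f \o cinv (chart_at p)) df.

(* What the chain rule for [mderiv] needs to know about the chart singled out
   at p; unlike [is_chart], it involves no other point, so that it is easy to
   check for products and for the cotangent bundle. *)
Record chart_ok (E : normedModType R) (M : charted E) (p : M) : Prop :=
  ChartOk {
  ok_nbhs : nbhs p (cdom (chart_at p));
  ok_cod : ccod (chart_at p) (cmap (chart_at p) p);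
  ok_mapK : forall q, cdom (chart_at p) q ->
    cinv (chart_at p) (cmap (chart_at p) q) = q;
  ok_cont : {for cmap (chart_at p) p, continuous (cinv (chart_at p))};
  ok_invK : \forall e \near cmap (chart_at p) p,
    cmap (chart_at p) (cinv (chart_at p) e) = e
}.

Section OneChart.
Variables (E : normedModType R) (M : charted E).

Lemma ok_mem (p : M) : chart_ok p -> cdom (chart_at p) p.
Proof. by case=> /nbhs_singleton. Qed.

Lemma ok_cinv (p : M) :
  chart_ok p -> cinv (chart_at p) (cmap (chart_at p) p) = p.
Proof. by move=> p_ok; apply: ok_mapK p_ok _ (ok_mem p_ok). Qed.

Lemma manifold_chart_ok : is_manifold M -> forall p : M, chart_ok p.
Proof.
move=> hM p; have [od oc mc id_ mK iK cm ci] := mfd_chart hM p.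
have pd := mfd_center hM p.
split=> //; [by apply: open_nbhs_nbhs; split | exact: mc | exact/ci/mc |].
apply: (filterS (P := ccod (chart_at p))) => //; rewrite nbhsE.
by exists (ccod (chart_at p)) => //; split=> //; exact: mc.
Qed.

End OneChart.

Section Charts.
Variables (E F H : normedModType R).
Variables (M : charted E) (N : charted F) (Q : charted H).

Lemma vspace_chart_ok (x : vspace_charted E) : chart_ok x.
Proof.
split=> //; first exact: (@filterT _ (nbhs x)).
by near=> e.
Unshelve. all: by end_near. Qed.

Lemma prod_chart_ok (p : prod_charted M N) :
  chart_ok p.1 -> chart_ok p.2 -> chart_ok p.
Proof.
move=> [a b c d e] [a' b' c' d' e']; split=> //=.
- by exists (cdom (chart_at p.1), cdom (chart_at p.2)).
- by move=> [q1 q2] [/= /c -> /c' ->].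
- apply: cvg_pair => /= W.
    move=> /d dW; exists (cinv (chart_at p.1) @^-1` W, setT);
      last by case=> ? ? [].
    by split=> //; exact: (@filterT _ (nbhs (cmap (chart_at p.2) p.2))).
  move=> /d' dW; exists (setT, cinv (chart_at p.2) @^-1` W);
    last by case=> ? ? [].
  by split=> //; exact: (@filterT _ (nbhs (cmap (chart_at p.1) p.1))).
- exists ([set x | cmap (chart_at p.1) (cinv (chart_at p.1) x) = x],
          [set y | cmap (chart_at p.2) (cinv (chart_at p.2) y) = y]) => //.
  by move=> [x y] [/= -> ->].
Qed.

Lemma has_mderivE (f : M -> N) p df :
  has_mderiv f p df -> mderiv f p = df :> (E -> F).
Proof. by case=> _ [_ <-]. Qed.

Lemma has_mderiv_uniq (f g : M -> N) p df dg :
  has_mderiv f p df -> has_mderiv g p dg -> f =1 g -> df =1 dg.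
Proof.
move=> fd gd /funext fg v; rewrite fg in fd.
by rewrite -(has_mderivE fd) (has_mderivE gd).
Qed.

Lemma smooth_on_has_mderiv (U : set M) (f : M -> N) p :
  chart_ok p -> chart_ok (f p) -> U p -> smooth_on U f ->
  has_mderiv f p (mderiv f p).
Proof.
move=> pok fok Up [fc fs]; split; first exact: fc.
have [+ _] := fs p (f p) 1%N; move=> /(_ (cmap (chart_at p) p)) h.
apply/differentiableP/h; rewrite /= ok_cinv //; split=> //; last exact: ok_mem.
exact: ok_cod.
Qed.

Lemma smooth_has_mderiv (f : M -> N) p :
  chart_ok p -> chart_ok (f p) -> smooth f -> has_mderiv f p (mderiv f p).
Proof. by move=> pok fok; exact: smooth_on_has_mderiv. Qed.

Lemma has_mderiv_near_eq (f g : M -> N) p df :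
  chart_ok p -> {near p, f =1 g} -> has_mderiv f p df -> has_mderiv g p df.
Proof.
move=> pok fg [fc fd]; split; first exact: continuous_near_eq fc.
rewrite -(nbhs_singleton fg); apply: is_diff_near_eq fd.
have h : \forall e \near cmap (chart_at p) p,
    f (cinv (chart_at p) e) = g (cinv (chart_at p) e).
  by have := ok_cont pok; rewrite /prop_for /continuous_at ok_cinv //
    => /(_ _ fg).
by near=> e => /=; congr cmap; near: e.
Unshelve. all: by end_near.
Qed.

Lemma has_mderiv_eq (f : M -> N) p df dg :
  has_mderiv f p df -> df = dg -> has_mderiv f p dg.
Proof. by move=> ? <-. Qed.

Lemma has_mderiv_comp (f : M -> N) (g : N -> Q) p df dg :
  chart_ok p -> chart_ok (f p) ->
  has_mderiv f p df -> has_mderiv g (f p) dg ->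
  has_mderiv (g \o f) p (dg \o df).
Proof.
move=> pok fok [fc fd] [gc gd]; split; first exact: continuous_comp fc gc.
pose F_ := cmap (chart_at (f p)) \o f \o cinv (chart_at p).
have FE : F_ (cmap (chart_at p) p) = cmap (chart_at (f p)) (f p).
  by rewrite /F_ /= ok_cinv.
rewrite -FE in gd; apply: is_diff_near_eq (is_diff_comp fd gd).
(* The chart at [f p] cancels with its inverse only where [f] stays in its domain; continuity of [f]
   provides this near [p]. *)
have /= h : \forall e \near cmap (chart_at p) p,
    cdom (chart_at (f p)) (f (cinv (chart_at p) e)).
  have fc' : f (cinv (chart_at p) e) @[e --> cmap (chart_at p) p] --> f p.
    rewrite -[in X in _ --> X](ok_cinv pok).
    apply: continuous_comp; first exact: ok_cont.
    by rewrite ok_cinv.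
  exact: fc' (ok_nbhs fok).
by apply: filterS h => e he /=; rewrite (ok_mapK fok).
Qed.

Lemma has_mderiv_id (p : M) : chart_ok p -> has_mderiv (id : M -> M) p id.
Proof.
move=> pok; split; first by [].
apply: is_diff_near_eq (is_diff_id _).
by apply: filterS (ok_invK pok) => e /= ->.
Qed.

Lemma has_mderiv_cst (q : N) (p : M) : has_mderiv (cst q : M -> N) p (fun=> 0).
Proof.
by split; [exact: cst_continuous | exact: (is_diff_cst (cmap (chart_at q) q))].
Qed.

Lemma has_mderiv_pair (f : Q -> M) (g : Q -> N) p df dg :
  has_mderiv f p df -> has_mderiv g p dg ->
  has_mderiv (N := prod_charted M N) (fun x => (f x, g x)) p
             (fun v => (df v, dg v)).
Proof.
move=> [fc fd] [gc gd]; split; first exact: cvg_pair fc gc.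
exact: is_diff_pair fd gd.
Qed.

Lemma has_mderiv_fst (p : prod_charted M N) :
  chart_ok p.1 -> has_mderiv (M := prod_charted M N) (N := M) fst p fst.
Proof.
move=> pok; split; first exact: cvg_fst.
have h : \forall e \near cmap (chart_at p) p,
    e.1 = (cmap (chart_at p.1) \o fst \o cinv (chart_at p)) e.
  exists ([set x | cmap (chart_at p.1) (cinv (chart_at p.1) x) = x], setT).
    by split; [exact: ok_invK | exact: filterT].
  by move=> [x y] [/= -> _].
exact: is_diff_near_eq h (is_diff_fst _).
Qed.

Lemma has_mderiv_snd (p : prod_charted M N) :
  chart_ok p.2 -> has_mderiv (M := prod_charted M N) (N := N) snd p snd.
Proof.
move=> pok; split; first exact: cvg_snd.
have h : \forall e \near cmap (chart_at p) p,
    e.2 = (cmap (chart_at p.2) \o snd \o cinv (chart_at p)) e.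
  exists (setT, [set x | cmap (chart_at p.2) (cinv (chart_at p.2) x) = x]).
    by split; [exact: filterT | exact: ok_invK].
  by move=> [x y] [/= _ ->].
exact: is_diff_near_eq h (is_diff_snd _).
Qed.

Lemma has_mderiv_vspace (f df : E -> F) (x : E) :
  has_mderiv (M := vspace_charted E) (N := vspace_charted F) f x df <->
  is_diff x f df.
Proof.
split=> [[] //|h]; split; last exact: h.
exact: (differentiable_continuous (ex_diff (is_diff_def := h))).
Qed.

End Charts.

End Derivatives.

(** * The adjoint representation *)

Section GroupDerivatives.
Variables (R : realType) (d : nat) (G : lieGroup R d).
Local Notation "x ** y" :=
  (@lg_mul R d G x y) (at level 40, left associativity).
Local Notation inv := (@lg_inv R d G).
Local Notation one := (lg_one G).
Implicit Types (g h : G) (X Y Z W : 'rV[R]_d).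

Lemma lg_chart_ok g : chart_ok g.
Proof. exact: manifold_chart_ok (lg_mfd G) g. Qed.

Lemma lg_invM g h : inv (g ** h) = inv h ** inv g.
Proof.
rewrite -[LHS](lg_mulg1 (l := G)) -(lg_mulgV (l := G) g).
rewrite -[in X in X ** inv g](lg_mulg1 (l := G) g) -(lg_mulgV (l := G) h).
by rewrite !lg_mulA -(lg_mulA (inv _) g h) lg_mulVg lg_mul1g.
Qed.

Lemma lg_inv1 : inv one = one.
Proof. by rewrite -[LHS](lg_mulg1 (l := G)) lg_mulVg. Qed.

Lemma lg_mulI g h k : g ** h = g ** k -> h = k.
Proof.
by move=> /(congr1 (lg_mul (inv g))); rewrite !lg_mulA lg_mulVg !lg_mul1g.
Qed.

Definition lg_mul_diff (p : G * G) :
    {linear ('rV[R]_d * 'rV[R]_d)%type -> 'rV[R]_d} :=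
  mderiv (M := prod_charted G G) (N := G) (fun xy => lg_mul xy.1 xy.2) p.

Lemma has_mderiv_lg_mul (E : normedModType R) (M : charted E) (f g : M -> G)
    p df dg :
  chart_ok p -> has_mderiv f p df -> has_mderiv g p dg ->
  has_mderiv (fun x => f x ** g x) p
             (fun v => lg_mul_diff (f p, g p) (df v, dg v)).
Proof.
move=> pok fd gd.
have ok2 : chart_ok ((f p, g p) : prod_charted G G).
  by apply: prod_chart_ok; exact: lg_chart_ok.
have md := smooth_has_mderiv ok2 (lg_chart_ok _) (lg_mul_smooth G).
exact: (has_mderiv_comp pok ok2 (has_mderiv_pair fd gd) md).
Qed.

(** Multiplication restricted to either axis through the identity is the identity map; linearity of
    the differential adds the two contributions. *)
Lemma lg_mul_diff1 X Y : lg_mul_diff (one, one) (X, Y) = X + Y.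
Proof.
have h1 : lg_mul_diff (one, one) (X, 0) = X.
  have := has_mderiv_lg_mul (lg_chart_ok one) (has_mderiv_id (lg_chart_ok one))
    (has_mderiv_cst (one : G) one).
  have -> : (fun x : G => id x ** cst one x) = id.
    by apply/funext => x /=; rewrite lg_mulg1.
  move/has_mderivE/(congr1 (@^~ X)) => /= <-.
  by rewrite (has_mderivE (has_mderiv_id (lg_chart_ok one))).
have h2 : lg_mul_diff (one, one) (0, Y) = Y.
  have := has_mderiv_lg_mul (lg_chart_ok one) (has_mderiv_cst (one : G) one)
    (has_mderiv_id (lg_chart_ok one)).
  have -> : (fun x : G => cst one x ** id x) = id.
    by apply/funext => x /=; rewrite lg_mul1g.
  move/has_mderivE/(congr1 (@^~ Y)) => /= <-.
  by rewrite (has_mderivE (has_mderiv_id (lg_chart_ok one))).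
by rewrite -[in RHS]h1 -[in RHS]h2 -linearD -[_ + _]/(_, _) /= addr0 add0r.
Qed.

Definition lg_conj g h : G := g ** h ** inv g.

Lemma lg_conj1 g : lg_conj g one = one.
Proof. by rewrite /lg_conj lg_mulg1 lg_mulgV. Qed.

Lemma has_mderiv_conj g : has_mderiv (lg_conj g) one (Ad g).
Proof.
have ok1 := lg_chart_ok one.
have := has_mderiv_lg_mul ok1 (has_mderiv_lg_mul ok1 (has_mderiv_cst g one)
  (has_mderiv_id ok1)) (has_mderiv_cst (inv g) one).
by move=> /[dup] /has_mderivE <-.
Qed.

Lemma Ad_mul g h X : Ad (g ** h) X = Ad g (Ad h X).
Proof.
have hg : has_mderiv (lg_conj g) (lg_conj h one) (Ad g).
  by rewrite lg_conj1; exact: has_mderiv_conj.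
have := has_mderiv_comp (lg_chart_ok _) (lg_chart_ok _) (has_mderiv_conj h) hg.
have -> : lg_conj g \o lg_conj h = lg_conj (g ** h).
  by apply/funext => x; rewrite /lg_conj /= lg_invM !lg_mulA.
by move/has_mderivE/(congr1 (@^~ X)).
Qed.

Lemma Ad1 X : Ad one X = X.
Proof.
have := has_mderiv_id (lg_chart_ok one).
have -> : id = lg_conj one.
  by apply/funext => x; rewrite /lg_conj /= lg_mul1g lg_inv1 lg_mulg1.
by move/has_mderivE/(congr1 (@^~ X)).
Qed.

Section AdSmooth.
Local Notation c := (chart_at (one : G)).
Local Notation o := (cmap c one).

Let m (z : ('rV[R]_d * 'rV[R]_d)%type) := cmap c (cinv c z.1 ** cinv c z.2).
Let j (a : 'rV[R]_d) := cmap c (inv (cinv c a)).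

Let c_chart : is_chart c := mfd_chart (lg_mfd G) one.
Let c_one : cdom c one := mfd_center (lg_mfd G) one.

(** Smoothness is used at order two: [Ad] already involves ['d m], and the bracket differentiates it
    once more. *)
Let m_diff z : ccod c z.1 -> ccod c z.2 -> cdom c (cinv c z.1 ** cinv c z.2) ->
  differentiable m z /\ forall v, differentiable (fun y => 'd m y v) z.
Proof.
move=> c1 c2 c3.
have [_ /(_ (one, one) one 2%N)] := lg_mul_smooth G.
move=> [/(_ z) h1 h2]; split; first by apply: h1.
by move=> v; have [/(_ z) h3 _] := h2 v; apply: h3.
Qed.

(* The chart at g jumps with g, so the tangent map of conjugation by g is
   computed in the single chart at 1, through the partial derivatives of the
   multiplication there, which depend differentiably on g. *)
Let AdE Y : \forall a \near o,
  Ad (cinv c a) Y = 'd m (a, j a) ('d m (a, o) (0, Y), 0).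
Proof.
have [oc1 oc2 mc id_ mK iK cm ci] := c_chart.
have oo : ccod c o by exact: mc.
have n1 : \forall a \near o, ccod c a by apply: open_nbhs_nbhs; split.
have n2 : \forall a \near o, cdom c (inv (cinv c a)).
  have ic : {for o, continuous (inv \o cinv c)}.
    apply: continuous_comp; first exact: ci.
    by rewrite mK //; have [ic _] := lg_inv_smooth G; exact: ic.
  apply: ic; rewrite /= mK // lg_inv1; apply: open_nbhs_nbhs; split=> //.
near=> a.
have ca : ccod c a by near: a.
have ia : cdom c (inv (cinv c a)) by near: a.
have ga := id_ _ ca.
have ja : ccod c (j a) by exact: mc.
have mao : m (a, o) = a by rewrite /m /= mK // lg_mulg1 iK.
have [d1 _] : differentiable m (a, o) /\
    forall v, differentiable (fun y => 'd m y v) (a, o).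
  by apply: m_diff => //=; rewrite mK // lg_mulg1.
have [d2 _] : differentiable m (a, j a) /\
    forall v, differentiable (fun y => 'd m y v) (a, j a).
  by apply: m_diff => //=; rewrite /j mK // lg_mulgV.
have i1 : is_diff o (fun x => (a, x)) (fun v => (0, v)).
  exact: is_diff_pair (is_diff_cst a o) (is_diff_id o).
have i2 : is_diff o (fun x => m (a, x)) (fun v => 'd m (a, o) (0, v)).
  exact: is_diff_comp i1 (differentiableP d1).
have i3 : is_diff o (fun x => (m (a, x), j a))
    (fun v => ('d m (a, o) (0, v), 0)).
  exact: is_diff_pair i2 (is_diff_cst (j a) o).
have i4 : is_diff o (fun x => m (m (a, x), j a))
    (fun v => 'd m (a, j a) ('d m (a, o) (0, v), 0)).
  apply: (is_diff_comp i3 (g := m) (dg := 'd m (a, j a))).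
  by rewrite mao; exact: differentiableP.
suff hm : has_mderiv (lg_conj (cinv c a)) one
    (fun v => 'd m (a, j a) ('d m (a, o) (0, v), 0)).
  by have /(congr1 (@^~ Y)) := has_mderivE hm.
split; first by have [] := has_mderiv_conj (cinv c a).
rewrite lg_conj1; apply: is_diff_near_eq i4.
(* The expression through [m] agrees with conjugation only while the intermediate product stays in
   the chart domain, where it can be decoded. *)
have n3 : \forall x \near o, cdom c (cinv c a ** cinv c x).
  have lc : {for o, continuous ((fun x => cinv c a ** x) \o cinv c)}.
    apply: continuous_comp; first exact: ci.
    have := has_mderiv_lg_mul (lg_chart_ok (cinv c o))
      (has_mderiv_cst (cinv c a) _)
      (has_mderiv_id (lg_chart_ok _)).
    by case.
  by apply: lc; rewrite /= mK // lg_mulg1; apply: open_nbhs_nbhs.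
apply: (filterS _ n3) => x xn; rewrite /m /j /lg_conj /= mK // mK.
Unshelve. all: by end_near. Qed.

(** Gives [lie_br] its meaning: being a [mderiv], it is informative only once [g |-> Ad g Y] is
    known to be differentiable at the identity. *)
Lemma has_mderiv_Ad Y :
  has_mderiv (N := vspace_charted 'rV[R]_d) (fun g : G => Ad g Y) one
    (fun X => lie_br G X Y).
Proof.
have [oc1 oc2 mc id_ mK iK cm ci] := c_chart.
have oo : ccod c o by exact: mc.
pose A a := 'd m (a, j a) ('d m (a, o) (0, Y), 0).
have jo : j o = o by rewrite /j mK // lg_inv1.
have Ad_diff : differentiable A o.
  have [d1 dd] : differentiable m (o, o) /\
      forall v, differentiable (fun y => 'd m y v) (o, o).
    by apply: m_diff => //=; rewrite mK // lg_mulg1.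
  have i1 : is_diff o (fun x => (x, o)) (fun v => (v, 0)).
    exact: is_diff_pair (is_diff_id o) (is_diff_cst o o).
  have i2 : is_diff o j (mderiv inv one).
    have [_ +] := smooth_has_mderiv (lg_chart_ok one) (lg_chart_ok _)
      (lg_inv_smooth G).
    by rewrite lg_inv1.
  have i3 : is_diff o (fun x => (x, j x)) (fun v => (v, mderiv inv one v)).
    exact: is_diff_pair (is_diff_id o) i2.
  have i4 := is_diff_comp i1 (differentiableP (dd (0, Y))).
  apply: (@differentiable_apply_linear _ _ _ _
           (fun a v => 'd m (a, j a) (v, 0))).
  - move=> a l u v; rewrite -linearP; congr ('d m _ _).
    by rewrite -[RHS]/(_, _) /= scaler0 addr0.
  - move=> v; have := is_diff_comp i3 (g := fun y => 'd m y (v, 0)) _.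
    by rewrite /= jo => /(_ _ (differentiableP (dd _))); case.
  - by case: i4.
have A_cont := differentiable_continuous Ad_diff.
have AdA : \forall a \near o, Ad (cinv c a) Y = A a by exact: AdE.
split.
  have AC : {for one, continuous (A \o cmap c)}.
    by apply: continuous_comp; [exact: cm | exact: A_cont].
  have near1 : \forall g \near (one : G), Ad g Y = (A \o cmap c) g.
    have n1 :
        \forall g \near (one : G), Ad (cinv c (cmap c g)) Y = A (cmap c g).
      exact: (cm _ c_one _ AdA).
    have n2 : \forall g \near (one : G), cdom c g by apply: open_nbhs_nbhs.
    near=> g; have cg : cdom c g by near: g.
    by rewrite -[in LHS](mK _ cg); near: g.
  by apply: continuous_near_eq AC; apply: filterS near1 => g ->.
have dA : is_diff o A ('d A o) by exact: differentiableP.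
have AAd : \forall a \near o, A a = Ad (cinv c a) Y.
  by apply: filterS AdA => a ->.
by have [h _] := is_diff_near_eq AAd dA; split; first exact: h.
Unshelve. all: by end_near. Qed.

End AdSmooth.

End GroupDerivatives.

(** * Curves with zero derivative *)

Lemma is_diff_R_cst (R : realType) d (f : R -> 'rV[R]_d) (x y : R) :
  (forall t, is_diff t f (fun=> 0)) -> f x = f y.
Proof.
move=> fd; apply/rowP => i.
apply: (@is_derive_0_is_cst R (fun t => f t 0 i)) => t.
have [h1 h2] := is_diff_coord 0 i (fd t).
split; first exact: diff_derivable.
by rewrite deriveE // h2 mxE.
Qed.

Lemma is_diff_R_cst_near (R : realType) d (f : R -> 'rV[R]_d) :
  (\forall t \near (0 : R), is_diff t f (fun=> 0)) ->
  \forall t \near (0 : R), f t = f 0.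
Proof.
move=> /nbhs_ballP[e /= e0 fd]; apply/nbhs_ballP; exists e => // t /= te.
apply/rowP => i.
have dfi u : ball (0 : R) e u -> is_diff u (fun t => f t 0 i) (fun=> 0).
  move=> ue; apply: is_diff_eq (is_diff_coord 0 i (fd u ue)) _.
  by apply/funext => v; rewrite mxE.
have der u : ball (0 : R) e u -> is_derive u (1 : R) (fun t => f t 0 i) 0.
  by move=> /dfi [h1 h2]; split;
    [exact: diff_derivable | rewrite deriveE // h2].
have cont u : ball (0 : R) e u -> {for u, continuous (fun t => f t 0 i)}.
  by move=> /dfi [h1 _]; exact: differentiable_continuous.
have ballE u : ball (0 : R) e u = (`|u| < e) :> Prop.
  by rewrite -ball_normE /= sub0r normrN.
suff cst a b : a <= b -> `|a| < e -> `|b| < e -> f a 0 i = f b 0 i.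
  rewrite ballE in te; have [t0|/ltW t0] := leP t 0.
    by apply: cst => //; rewrite normr0.
  by apply/esym/cst => //; rewrite normr0.
move=> ab ae be.
have inb u : u \in `[a, b]%R -> ball (0 : R) e u.
  rewrite in_itv /= ballE => /andP[au ub].
  move: ae be; rewrite !ltr_norml => /andP[ae _] /andP[_ be].
  by rewrite (lt_le_trans ae au) (le_lt_trans ub be).
have hder u : u \in `]a, b[%R -> is_derive u (1 : R) (fun t => f t 0 i) 0.
  by move=> uab; apply/der/inb; exact: subset_itv_oo_cc.
have hcont : {within `[a, b], continuous (fun t => f t 0 i)}.
  apply: continuous_in_subspaceT => u /[!inE] uab.
  by apply/cont/inb.
have [u _ /eqP] := MVT_segment ab hder hcont.
by rewrite mul0r subr_eq0 => /eqP.
Qed.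

(** * Bracket and Killing form *)

Section GroupAlgebra.
Variables (R : realType) (d : nat) (G : lieGroup R d).
Local Notation "x ** y" :=
  (@lg_mul R d G x y) (at level 40, left associativity).
Local Notation inv := (@lg_inv R d G).
Local Notation one := (lg_one G).
Local Notation br := (lie_br G).
Implicit Types (g h : G) (X Y Z W : 'rV[R]_d).

Lemma br_linear_l Y : linear (br^~ Y).
Proof. by move=> a u v; exact: linearP. Qed.

(** On the left, linearity is that of a tangent map. On the right it comes from linearity of each
    [Ad g], and passing to the derivative uses [has_mderiv_Ad]. *)
Lemma br_linear_r X : linear (br X).
Proof.
move=> a u v.
have [uc ud] := has_mderiv_Ad G u.
have [vc vd] := has_mderiv_Ad G v.
have h : has_mderiv (N := vspace_charted 'rV[R]_d)
    (fun g : G => a *: Ad g u + Ad g v) one (fun X => a *: br X u + br X v).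
  split; first by apply: cvgD => //; exact: cvgZl_tmp.
  exact: is_diffD (is_diffZ a ud) vd.
by apply: (has_mderiv_uniq (has_mderiv_Ad G _) h) => g; exact: linearP.
Qed.

Lemma brZl a X Y : br (a *: X) Y = a *: br X Y.
Proof. exact: linearZ. Qed.

Lemma brDr X Y Z : br X (Y + Z) = br X Y + br X Z.
Proof. by have := br_linear_r X 1 Y Z; rewrite !scale1r. Qed.

Lemma br0r X : br X 0 = 0.
Proof. by apply: (addrI (br X 0)); rewrite -brDr !addr0. Qed.

Lemma brZr a X Y : br X (a *: Y) = a *: br X Y.
Proof. by have := br_linear_r X a Y 0; rewrite !addr0 br0r addr0. Qed.

Definition adm X : 'M[R]_d := lin1_mx (br X).

Lemma mul_adm X Y : Y *m adm X = br X Y.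
Proof.
pose l : {linear 'rV[R]_d -> 'rV[R]_d} :=
  HB.pack (br X) (GRing.isLinear.Build _ _ _ _ _ (br_linear_r X)).
by rewrite /adm -[br X]/(l : _ -> _) mul_rV_lin1.
Qed.

(** Differentiate [Ad g (Ad h Y) = Ad (lg_conj g h) (Ad g Y)] in [h] at the identity. *)
Lemma Ad_br g X Y : Ad g (br X Y) = br (Ad g X) (Ad g Y).
Proof.
have h1 : has_mderiv (N := vspace_charted 'rV[R]_d)
    ((fun h => Ad h (Ad g Y)) \o lg_conj g) one
    ((fun X => br X (Ad g Y)) \o Ad g).
  apply: (has_mderiv_comp (lg_chart_ok _) (lg_chart_ok _) (has_mderiv_conj g)).
  by rewrite lg_conj1; exact: has_mderiv_Ad.
have h2 : has_mderiv (N := vspace_charted 'rV[R]_d)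
    ((Ad g : vspace_charted 'rV[R]_d -> vspace_charted 'rV[R]_d) \o
      (fun h => Ad h Y)) one (Ad g \o (fun X => br X Y)).
  apply: (has_mderiv_comp (lg_chart_ok _) (vspace_chart_ok _)
    (has_mderiv_Ad G Y)).
  by apply/has_mderiv_vspace/is_diff_linear_mx; exact: linearP.
have e : (Ad g : vspace_charted 'rV[R]_d -> vspace_charted 'rV[R]_d) \o
    (fun h => Ad h Y) =1 (fun h => Ad h (Ad g Y)) \o lg_conj g.
  move=> h; rewrite -[LHS]/(Ad g (Ad h Y)) -[RHS]/(Ad (lg_conj g h) (Ad g Y)).
  transitivity (Ad (g ** h) Y); first exact/esym/Ad_mul.
  transitivity (Ad (lg_conj g h ** g) Y); last exact: Ad_mul.
  by rewrite /lg_conj -!lg_mulA lg_mulVg lg_mulg1.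
exact: (has_mderiv_uniq h2 h1 e X).
Qed.

Lemma adm_linear : linear adm.
Proof.
by move=> a u v; apply/matrixP => i k; rewrite !mxE br_linear_l !mxE.
Qed.

(* The derivative of [Ad g [X, Y] = [Ad g X, Ad g Y]] at g = 1. *)
Lemma br_leibniz W X Y : br W (br X Y) = br (br W X) Y + br X (br W Y).
Proof.
pose o := cmap (chart_at (one : G)) one.
pose F X (a : 'rV[R]_d) := Ad (cinv (chart_at (one : G)) a) X.
have Fd Z : is_diff o (F Z) (fun W => br W Z) by have [_] := has_mderiv_Ad G Z.
have Fo Z : F Z o = Z by rewrite /F (ok_cinv (lg_chart_ok _)) Ad1.
have FE a : F (br X Y) a = F Y a *m adm (F X a).
  by rewrite mul_adm; exact: Ad_br.
have h := is_diff_mulmx (Fd Y)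
  (is_diff_comp (Fd X) (is_diff_linear_mx (F X o) adm_linear)).
have /= -> := is_diff_uniq (Fd (br X Y)) h FE W.
by rewrite !Fo !mul_adm.
Qed.

(* [adm] acts on rows, which reverses the order of composition. *)
Lemma adm_br W X : adm (br W X) = adm X *m adm W - adm W *m adm X.
Proof.
apply/row_matrixP => i.
by rewrite !rowE mulmxBr !mulmxA !mul_adm br_leibniz addrK.
Qed.

Local Notation K := (killing br).

Lemma killing_inv W X Z : K (br W X) Z = K W (br X Z).
Proof.
rewrite /killing -!/(adm _) !adm_br.
by rewrite mulmxBl mulmxBr 2!raddfB /= -mulmxA (mxtrace_mulC (adm X)) -!mulmxA.
Qed.

Lemma killing_sym X Y : K X Y = K Y X.
Proof. exact: mxtrace_mulC. Qed.

Lemma killing_linear_l Y : linear (K^~ Y).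
Proof.
move=> a u v; rewrite /killing -!/(adm _) adm_linear mulmxDl -scalemxAl.
by rewrite mxtraceD mxtraceZ.
Qed.

Lemma adm_sym X Y : adm (br X Y + br Y X) = 0.
Proof.
rewrite -[br X Y]scale1r adm_linear scale1r !adm_br.
by rewrite addrC addrA subrK subrr.
Qed.

Lemma killing_adm0 X Y : adm X = 0 -> K X Y = 0.
Proof. by rewrite /killing -!/(adm _) => ->; rewrite mul0mx raddf0. Qed.

(* The bracket, defined as a derivative of Ad, is not known to be antisymmetric
   at this point; but [X, Y] + [Y, X] acts trivially by the Leibniz rule, hence
   lies in the radical of the Killing form, which is all that is needed. *)
Lemma killing_brC X Y Z : K (br X Y) Z = - K (br Y X) Z.
Proof.
apply/eqP; rewrite -addr_eq0; have := killing_linear_l Z 1 (br X Y) (br Y X).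
by rewrite !scale1r => <-; rewrite killing_adm0 // adm_sym.
Qed.

End GroupAlgebra.

(** * One-parameter subgroups *)

Lemma has_mderiv_chart (R : realType) (E : normedModType R) (M : charted E)
    (hM : is_manifold M) (p q : M) : cdom (chart_at p) q ->
  has_mderiv (N := vspace_charted E) (cmap (chart_at p)) q
    ('d (cmap (chart_at p) \o cinv (chart_at q)) (cmap (chart_at q) q)).
Proof.
move=> pq; split; first exact: (chart_map_cont (mfd_chart hM p)).
apply/differentiableP.
have [/= h _] := mfd_transition hM q p 1%N.
apply: h; split; first exact: ok_cod (manifold_chart_ok hM q).
by rewrite /= (ok_cinv (manifold_chart_ok hM q)).
Qed.

(** Constancy is claimed only near 0 because the curve is read in the chart at [e 0], which it might
    leave later. *)
Lemma has_mderiv0_cst_near (R : realType) d (M : charted 'rV[R]_d)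
    (hM : is_manifold M) (e : vspace_charted R -> M) :
  (forall t, has_mderiv e t (fun=> 0)) -> \forall t \near (0 : R), e t = e 0.
Proof.
move=> he; have ok := manifold_chart_ok hM.
have n1 : \forall t \near (0 : R), cdom (chart_at (e 0)) (e t).
  by have [ec _] := he 0; exact: ec (ok_nbhs (ok _)).
have n2 : \forall t \near (0 : R),
    is_diff t (fun u : R => cmap (chart_at (e 0)) (e u)) (fun=> 0).
  apply: filterS n1 => t et.
  have := has_mderiv_comp (vspace_chart_ok t) (ok _) (he t)
    (has_mderiv_chart hM et).
  move=> /has_mderiv_vspace h; apply: is_diff_eq h _.
  by apply/funext => v /=; rewrite linear0.
apply: filterS2 n1 (is_diff_R_cst_near n2) => t et ct.
rewrite -(ok_mapK (ok (e 0)) et) ct; exact: ok_cinv.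
Qed.

Section OneParameter.
Variables (R : realType) (d : nat) (G : lieGroup R d).
Local Notation "x ** y" :=
  (@lg_mul R d G x y) (at level 40, left associativity).
Local Notation inv := (@lg_inv R d G).
Local Notation one := (lg_one G).
Local Notation br := (lie_br G).
Implicit Types (g h : G) (X Y Z W : 'rV[R]_d) (c : vspace_charted R -> G).

(** Differentiability is asked at 0 alone: the homomorphism law transports it elsewhere, so
    rescalings, conjugates and products are checked at a single point. *)
Definition one_param c X : Prop :=
  (forall s t, c (s + t) = c s ** c t) /\ has_mderiv c 0 (fun s => s *: X).

Lemma one_param0 c X : one_param c X -> c 0 = one.
Proof.
by case=> cD _; apply: (@lg_mulI R d G (c 0)); rewrite -cD addr0 lg_mulg1.
Qed.

Lemma one_paramN c X t : one_param c X -> c (- t) = inv (c t).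
Proof.
move=> hc; have [cD _] := hc; apply: (@lg_mulI R d G (c t)).
by rewrite -cD subrr lg_mulgV (one_param0 hc).
Qed.

(** Translate to 0 by [c u = c t ** c (u - t)]. With [Ad (c t)] factored out on the left, the
    derivative has the original form with [V] replaced by [br X V]; this drives the recursion on the
    nilpotency order below. *)
Lemma is_diff_one_param c X V t : one_param c X ->
  is_diff t (fun u : R => Ad (c u) V) (fun s => s *: Ad (c t) (br X V)).
Proof.
move=> hc; have [cD cd] := hc.
have hA : has_mderiv (N := vspace_charted 'rV[R]_d) (fun g : G => Ad g V) (c 0)
    (fun X => br X V) by rewrite (one_param0 hc); exact: has_mderiv_Ad.
have /has_mderiv_vspace h0 :=
  has_mderiv_comp (vspace_chart_ok _) (lg_chart_ok _) cd hA.
have h0' : is_diff (t - t) ((fun g : G => Ad g V) \o c)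
    ((fun X => br X V) \o (fun s => s *: X)) by rewrite subrr.
have h1 := is_diff_comp (is_diff_subr t t) h0'.
have hL : is_diff ((((fun g : G => Ad g V) \o c) \o (fun u : R => u - t)) t)
    (Ad (c t)) (Ad (c t)).
  by apply: is_diff_linear_mx; exact: linearP.
have h2 := is_diff_comp h1 hL.
have -> : (fun u : R => Ad (c u) V) =
    (Ad (c t) \o (((fun g : G => Ad g V) \o c) \o (fun u : R => u - t))).
  apply/funext => u; rewrite -[RHS]/(Ad (c t) (Ad (c (u - t)) V)).
  transitivity (Ad (c t ** c (u - t)) V); last exact: Ad_mul.
  by rewrite -cD addrC subrK.
apply: is_diff_eq h2 _; apply/funext => s.
rewrite -[LHS]/(Ad (c t) (br (s *: X) V)) brZl.
exact: linearZZ.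
Qed.

Lemma Ad_one_param_at0 c X V : one_param c X -> Ad (c 0) V = V.
Proof. by move=> hc; rewrite (one_param0 hc); exact: Ad1. Qed.

Lemma Ad_one_param0 c X V t : one_param c X -> br X V = 0 -> Ad (c t) V = V.
Proof.
move=> hc XV; have h u : is_diff u (fun u => Ad (c u) V) (fun=> 0).
  apply: is_diff_eq (is_diff_one_param V u hc) _.
  by apply/funext => s; rewrite XV linear0 scaler0.
exact: (etrans (is_diff_R_cst t 0 h) (Ad_one_param_at0 V hc)).
Qed.

Lemma Ad_one_param1 c X V t : one_param c X -> br X (br X V) = 0 ->
  Ad (c t) V = V + t *: br X V.
Proof.
move=> hc XV; apply/eqP; rewrite -subr_eq; apply/eqP.
have h u : is_diff u (fun u => Ad (c u) V - u *: br X V) (fun=> 0).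
  apply: is_diff_eq (is_diffB (is_diff_one_param V u hc)
    (is_diff_scalev (br X V) u)) _.
  apply/funext => s; rewrite -[LHS]/(s *: Ad (c u) (br X V) - s *: br X V).
  by rewrite (Ad_one_param0 _ hc XV) subrr.
apply: (etrans (is_diff_R_cst t 0 h)); rewrite scale0r subr0.
exact: Ad_one_param_at0 hc.
Qed.

Lemma Ad_one_param2 c X V t : one_param c X -> br X (br X (br X V)) = 0 ->
  Ad (c t) V = V + t *: br X V + (t ^+ 2 / 2) *: br X (br X V).
Proof.
move=> hc XV; apply/eqP; rewrite -subr_eq -subr_eq; apply/eqP.
(* Written as [t *: (t *: w)], the quadratic term falls under the product rule; its two equal
   contributions add up to [t *: br X (br X V)], which explains the factor one half. *)
pose w := 2^-1 *: br X (br X V).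
have -> : (t ^+ 2 / 2) *: br X (br X V) = t *: (t *: w) by rewrite /w !scalerA.
have h u :
    is_diff u (fun u => Ad (c u) V - u *: (u *: w) - u *: br X V) (fun=> 0).
  have hw := is_diff_scale (is_diff_id u) (is_diff_scalev w u).
  apply: is_diff_eq (is_diffB (is_diffB (is_diff_one_param V u hc) hw)
    (is_diff_scalev (br X V) u)) _.
  apply/funext => s.
  rewrite -[LHS]/(s *: Ad (c u) (br X V) - (u *: (s *: w) + s *: (u *: w))
    - s *: br X V).
  rewrite (Ad_one_param1 _ hc XV) scalerDr -addrA -opprD.
  apply/eqP; rewrite subr_eq0 addrC; apply/eqP; congr (_ + _).
  rewrite /w !scalerA -scalerDl; congr (_ *: _).
  by field.
apply: (etrans (is_diff_R_cst t 0 h)); rewrite !scale0r !subr0.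
exact: Ad_one_param_at0 hc.
Qed.

Lemma has_mderiv_lg_mul0 (E : normedModType R) (M : charted E)
    (f g : M -> G) p :
  chart_ok p -> has_mderiv f p (fun=> 0) -> has_mderiv g p (fun=> 0) ->
  has_mderiv (fun x => f x ** g x) p (fun=> 0).
Proof.
move=> pok hf hg; apply: has_mderiv_eq (has_mderiv_lg_mul pok hf hg) _.
by apply/funext => v; exact: linear0.
Qed.

(* t |-> c1 t * c2 (- t) has zero derivative, so c1 = c2 near 0, and the values
   near 0 generate all the others. *)
Lemma one_param_uniq c1 c2 X : one_param c1 X -> one_param c2 X -> c1 =1 c2.
Proof.
move=> h1 h2; have [c1D c1d] := h1; have [c2D c2d] := h2.
pose e (t : vspace_charted R) := c1 t ** c2 (- t).
have neg : has_mderiv (N := vspace_charted R)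
    (-%R : vspace_charted R -> vspace_charted R) 0 -%R.
  exact/has_mderiv_vspace.
have c2d' : has_mderiv c2 (- (0 : R)) (fun s => s *: X) by rewrite oppr0.
have c2n := has_mderiv_comp (vspace_chart_ok _) (vspace_chart_ok _) neg c2d'.
have ed : has_mderiv e 0 (fun=> 0).
  apply: has_mderiv_eq (has_mderiv_lg_mul (vspace_chart_ok _) c1d c2n) _.
  apply/funext => s; rewrite /= oppr0 (one_param0 h1) (one_param0 h2).
  by rewrite lg_mul_diff1 scaleNr subrr.
have e0 : e 0 = one.
  by rewrite /e oppr0 (one_param0 h1) (one_param0 h2) lg_mulg1.
(* Although [e] need not be a homomorphism, [e u = c1 t ** e (u - t) ** c2 (- t)] with constant
   outer factors, so the zero derivative at 0 spreads to every [t]. *)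
have edt t : has_mderiv e t (fun=> 0).
  have sh : has_mderiv (N := vspace_charted R)
      (fun u : vspace_charted R => (u - t : vspace_charted R)) t (fun s => s).
    by apply/has_mderiv_vspace; exact: is_diff_subr.
  have ed' : has_mderiv e (t - t) (fun=> 0) by rewrite subrr.
  have h3 := has_mderiv_comp (vspace_chart_ok _) (vspace_chart_ok _) sh ed'.
  have h4 := has_mderiv_lg_mul0 (vspace_chart_ok _)
    (has_mderiv_lg_mul0 (vspace_chart_ok _) (has_mderiv_cst (c1 t) _) h3)
    (has_mderiv_cst (c2 (- t)) _).
  have -> : e = (fun u => cst (c1 t) u ** (e \o (fun u => u - t)) u **
      cst (c2 (- t)) u).
    apply/funext => u; rewrite /e /= !lg_mulA -c1D -lg_mulA -c2D.
    congr (c1 _ ** c2 _); first by rewrite addrC subrK.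
    by rewrite opprB addrAC subrr add0r.
  exact: h4.
have /nbhs_ballP[r /= r0 er] := has_mderiv0_cst_near (lg_mfd G) edt.
have small t : `|t| < r -> c1 t = c2 t.
  move=> tr; have /er : ball (0 : R) r t by rewrite -ball_normE /= sub0r normrN.
  rewrite /= e0 /e (one_paramN _ h2) => /(congr1 (fun g => g ** c2 t)).
  by rewrite -lg_mulA lg_mulVg lg_mulg1 lg_mul1g.
move=> t.
have [N Nt] : exists N : nat, `|t| / r < N.+1%:R.
  exists (Num.truncn (`|t| / r)); exact: truncnS_gt.
pose s := t / N.+1%:R.
have sE : c1 s = c2 s.
  apply: small; rewrite /s normrM normfV (ger0_norm (ler0n _ _)).
  by rewrite ltr_pdivrMr ?ltr0n // mulrC -ltr_pdivrMr.
have -> : t = s *+ N.+1 by rewrite /s -mulr_natr divfK // pnatr_eq0.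
elim: N.+1 => [|q IH]; first by rewrite mulr0n (one_param0 h1) (one_param0 h2).
by rewrite mulrS c1D c2D IH sE.
Qed.

Lemma one_param_scale c X a :
  one_param c X -> one_param (fun t => c (a * t)) (a *: X).
Proof.
move=> [cD cd]; split=> [s t|]; first by rewrite mulrDr cD.
have sc := (has_mderiv_vspace _ _ (0 : R)).2
  (is_diff_scaler (V := R) a (0 : R)).
have cd' : has_mderiv c (a * 0) (fun s => s *: X) by rewrite mulr0.
have h := has_mderiv_comp (vspace_chart_ok _) (vspace_chart_ok _) sc cd'.
apply: has_mderiv_eq h _.
by apply/funext => s /=; rewrite scalerA mulrC.
Qed.

Lemma one_param_conj c X g :
  one_param c X -> one_param (fun t => lg_conj g (c t)) (Ad g X).
Proof.
move=> hc; have [cD cd] := hc; split=> [s t|].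
  by rewrite cD /lg_conj !lg_mulA -(lg_mulA _ (inv g) g) lg_mulVg lg_mulg1.
have hg : has_mderiv (lg_conj g) (c 0) (Ad g).
  by rewrite (one_param0 hc); exact: has_mderiv_conj.
have h := has_mderiv_comp (vspace_chart_ok _) (lg_chart_ok _) cd hg.
apply: has_mderiv_eq h _.
by apply/funext => s /=; exact: linearZ.
Qed.

(** The two subgroups commute: conjugating [c2] by [c1 s] gives a one-parameter subgroup with
    velocity [Ad (c1 s) Y = Y], which is [c2] by uniqueness. *)
Lemma one_param_mul c1 c2 X Y :
  one_param c1 X -> one_param c2 Y -> br X Y = 0 ->
  one_param (fun t => c1 t ** c2 t) (X + Y).
Proof.
move=> h1 h2 XY; have [c1D c1d] := h1; have [c2D c2d] := h2.
have comm s t : c1 s ** c2 t = c2 t ** c1 s.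
  have := one_param_conj (c1 s) h2; rewrite (Ad_one_param0 s h1 XY).
  move=> /(one_param_uniq h2)/(_ t) E; rewrite [in RHS]E.
  by rewrite /lg_conj -!lg_mulA lg_mulVg lg_mulg1.
split=> [s t|].
  by rewrite c1D c2D !lg_mulA -(lg_mulA (c1 s)) comm !lg_mulA.
apply: has_mderiv_eq (has_mderiv_lg_mul (vspace_chart_ok _) c1d c2d) _.
apply/funext => s; rewrite /= (one_param0 h1) (one_param0 h2).
by rewrite lg_mul_diff1 scalerDr.
Qed.

Lemma is_exp_one_param X g : is_exp X g -> exists2 c, one_param c X & c 1 = g.
Proof.
move=> [c [cs cD cX c1]]; exists c => //; split=> //.
have h := smooth_has_mderiv (vspace_chart_ok 0) (lg_chart_ok _) cs.
apply: has_mderiv_eq h _; apply/funext => s; rewrite -cX -[in LHS](mulr1 s).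
exact: linearZ.
Qed.

End OneParameter.

(** * Graded Lie algebras and parabolic subgroups *)

Section Pairing.
Variables (R : realType) (n : nat).
Implicit Types (v : 'rV[R]_n) (a b : 'cV[R]_n).

Lemma pairingD v a b : pairing v (a + b) = pairing v a + pairing v b.
Proof. by rewrite /pairing mulmxDr mxE. Qed.

Lemma pairingN v a : pairing v (- a) = - pairing v a.
Proof. by rewrite /pairing mulmxN mxE. Qed.

Lemma pairingZ v (c : R) a : pairing v (c *: a) = c * pairing v a.
Proof. by rewrite /pairing -scalemxAr mxE. Qed.

Lemma pairing_inj a b : (forall v, pairing v a = pairing v b) -> a = b.
Proof.
move=> h; apply/colP => i; have := h (delta_mx 0 i).
by rewrite /pairing -!rowE !mxE.
Qed.

End Pairing.

Section Graded.
Variables (R : realType) (N n m k : nat) (D : parabolicData R N n m k).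
Local Notation gr := (pd_gr D).
Local Notation br := (lie_br (pd_G D)).
Local Notation K := (killing (lie_br (pd_G D))).
Implicit Types (X Y : 'rV[R]_n) (A : 'rV[R]_m) (Z W : 'rV[R]_k) (V : 'rV[R]_N).

Lemma gr_ids :
  [/\ in_m1 gr *m pr_m1 gr = 1%:M, in_0 gr *m pr_0 gr = 1%:M
    & in_1 gr *m pr_1 gr = 1%:M] /\
  [/\ in_m1 gr *m pr_0 gr = 0, in_m1 gr *m pr_1 gr = 0,
      in_0 gr *m pr_m1 gr = 0 & in_0 gr *m pr_1 gr = 0] /\
  in_1 gr *m pr_m1 gr = 0 /\ in_1 gr *m pr_0 gr = 0.
Proof.
have := dec_inK gr; rewrite mul_col_row scalar_mx_block => /eq_block_mx[].
rewrite mul_col_row scalar_mx_block => /eq_block_mx[e1 e2 e3 e4].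
rewrite mul_col_mx -col_mx0 => /eq_col_mx[e5 e6].
by rewrite mul_mx_row -row_mx0 => /eq_row_mx[e7 e8] e9.
Qed.

Lemma gr_dec V : V = V *m pr_m1 gr *m in_m1 gr + V *m pr_0 gr *m in_0 gr
  + V *m pr_1 gr *m in_1 gr.
Proof. by rewrite -!mulmxA -!mulmxDr dec_prK mulmx1. Qed.

Lemma gcomp_m1 X : gcomp gr (-1) (X *m in_m1 gr).
Proof. by exists X. Qed.

Lemma gcomp_0 A : gcomp gr 0 (A *m in_0 gr).
Proof. by exists A. Qed.

Lemma gcomp_1 Z : gcomp gr 1 (Z *m in_1 gr).
Proof. by exists Z. Qed.

(** Degree [1 + 1] falls in the default case [[set 0]] of [gcomp], so membership is the equation
    itself. *)
Lemma br_11 Z W : br (Z *m in_1 gr) (W *m in_1 gr) = 0.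
Proof. exact: (pd_graded (gcomp_1 Z) (gcomp_1 W)). Qed.

Lemma br_10 Z A : exists W, br (Z *m in_1 gr) (A *m in_0 gr) = W *m in_1 gr.
Proof. by have [W _ <-] := pd_graded (gcomp_1 Z) (gcomp_0 A); exists W. Qed.

Lemma br_1m1 Z X : exists A, br (Z *m in_1 gr) (X *m in_m1 gr) = A *m in_0 gr.
Proof. by have [W _ <-] := pd_graded (gcomp_1 Z) (gcomp_m1 X); exists W. Qed.

Lemma br_m11 X Z : exists A, br (X *m in_m1 gr) (Z *m in_1 gr) = A *m in_0 gr.
Proof. by have [W _ <-] := pd_graded (gcomp_m1 X) (gcomp_1 Z); exists W. Qed.

Lemma br_01 A Z : exists W, br (A *m in_0 gr) (Z *m in_1 gr) = W *m in_1 gr.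
Proof. by have [W _ <-] := pd_graded (gcomp_0 A) (gcomp_1 Z); exists W. Qed.

Lemma br_0m1 A X : exists Y, br (A *m in_0 gr) (X *m in_m1 gr) = Y *m in_m1 gr.
Proof. by have [W _ <-] := pd_graded (gcomp_0 A) (gcomp_m1 X); exists W. Qed.

(** Each bracket with [g_1] raises the degree by one, and three steps from degree at least -1 leave
    the grading. *)
Lemma br1_cubed Z V :
  br (Z *m in_1 gr) (br (Z *m in_1 gr) (br (Z *m in_1 gr) V)) = 0.
Proof.
rewrite (gr_dec V) !brDr.
set X := V *m pr_m1 gr; set A := V *m pr_0 gr; set W := V *m pr_1 gr.
have [A' ->] := br_1m1 Z X; have [W' ->] := br_10 Z A'.
have [W'' ->] := br_10 Z A.
by rewrite !br_11 !br0r !addr0.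
Qed.

Lemma pairing_psiB X Z :
  pairing X (psiB D Z) = pd_c D * K (Z *m in_1 gr) (X *m in_m1 gr).
Proof.
pose f (Y : 'rV[R]_n) := pd_c D * K (Z *m in_1 gr) (Y *m in_m1 gr).
have f_lin : linear f.
  move=> a u v; rewrite /f !(killing_sym _ (Z *m in_1 gr)) mulmxDl -scalemxAl.
  by rewrite killing_linear_l mulrDr mulrCA.
pose fL : {linear 'rV[R]_n -> R} :=
  HB.pack f (GRing.isLinear.Build _ _ _ _ _ f_lin).
rewrite -[RHS]/(fL X) [in RHS](row_sum_delta X) linear_sum /pairing mxE.
by apply: eq_bigr => i _; rewrite linearZ mxE.
Qed.

Lemma psiB_linear : linear (psiB D).
Proof.
move=> a u v; apply: pairing_inj => X.
rewrite pairing_psiB mulmxDl -scalemxAl killing_linear_l mulrDr mulrCA.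
by rewrite -!pairing_psiB pairingD pairingZ.
Qed.

Lemma psiB_br_10 Z A :
  psiB D (br (Z *m in_1 gr) (A *m in_0 gr) *m pr_1 gr) =
  - rho_dual D A (psiB D Z).
Proof.
have [[i1 i2 i3] _] := gr_ids.
apply: pairing_inj => X; rewrite pairing_psiB.
(* The bracket already lies in [g_1], so projecting by [pr_1] and including again leaves it
   unchanged; invariance of the Killing form can then be applied. *)
have [W E] := br_10 Z A; rewrite E -(mulmxA W) i3 mulmx1 -E killing_inv.
rewrite /rho_dual opprK {1}/pairing mulmxA.
pose f X := br (A *m in_0 gr) (X *m in_m1 gr) *m pr_m1 gr.
have f_lin : linear f.
  by move=> a u v; rewrite /f mulmxDl -scalemxAl brDr brZr mulmxDl -scalemxAl.
pose fL : {linear 'rV[R]_n -> 'rV[R]_n} :=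
  HB.pack f (GRing.isLinear.Build _ _ _ _ _ f_lin).
have -> : X *m lin1_mx (fun X0 : 'rV[R]_n =>
    pd_br D (A *m in_0 gr) (X0 *m in_m1 gr) *m pr_m1 gr) = f X.
  exact: (mul_rV_lin1 fL X).
rewrite -/(pairing (f X) (psiB D Z)) pairing_psiB /f.
by have [Y ->] := br_0m1 A X; rewrite -(mulmxA Y) i1 mulmx1.
Qed.

Lemma pairing_triple X Y Z : pairing Y (psiB D (triple_br D X Z Z)) =
  - (pd_c D * K (br (Z *m in_1 gr) (X *m in_m1 gr))
      (br (Z *m in_1 gr) (Y *m in_m1 gr))).
Proof.
have [[i1 i2 i3] _] := gr_ids.
rewrite pairing_psiB /triple_br -/(lie_br (pd_G D)).
have [A EA] := br_m11 X Z; have [W EW] := br_01 A Z.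
rewrite /pd_br EA EW -(mulmxA W) i3 mulmx1 -EW -EA killing_inv killing_brC.
by rewrite mulrN.
Qed.

Lemma pairing_triple_sym X Y Z :
  pairing Y (psiB D (triple_br D X Z Z)) =
  pairing X (psiB D (triple_br D Y Z Z)).
Proof.
rewrite (pairing_triple X Y Z) (pairing_triple Y X Z).
exact: (congr1 (fun x => - (pd_c D * x))
  (killing_sym (pd_G D) (br (Z *m in_1 gr) _) (br (Z *m in_1 gr) _))).
Qed.

(** This is [[Z, [Z, X]] = [[X, Z], Z]], but antisymmetry is at hand only inside the Killing form,
    so the two sides are compared after [psiB] and pairing with an arbitrary [Y]. *)
Lemma psiB_br_11m1 Z X :
  psiB D (br (Z *m in_1 gr) (br (Z *m in_1 gr) (X *m in_m1 gr)) *m pr_1 gr) =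
  psiB D (triple_br D X Z Z).
Proof.
have [[i1 i2 i3] _] := gr_ids.
apply: pairing_inj => Y; rewrite pairing_triple pairing_psiB.
have [A EA] := br_1m1 Z X; have [W EW] := br_10 Z A.
by rewrite EA EW -(mulmxA W) i3 mulmx1 -EW killing_brC killing_inv mulrN.
Qed.

End Graded.

(** * The exponential map on [g_1] *)

Section Exp.
Variables (R : realType) (N n m k : nat) (D : parabolicData R N n m k).
Local Notation gr := (pd_gr D).
Local Notation br := (lie_br (pd_G D)).
Local Notation ii := (@pd_i _ _ _ _ _ D).
Implicit Types (Z W : 'rV[R]_k) (V : 'rV[R]_N).

Lemma pd_iM p q : ii (lg_mul p q) = lg_mul (ii p) (ii q).
Proof. by have [-> _] := pd_i_sub D. Qed.

Lemma pd_i_inj : injective ii.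
Proof. by have [_ []] := pd_i_sub D. Qed.

Lemma pd_i_smooth : smooth ii.
Proof. by have [_ []] := pd_i_sub D. Qed.

Lemma pd_exp_smooth : smooth (pd_exp D).
Proof. by have [] := pd_exp_emb D. Qed.

Lemma pd_i1 : ii (lg_one _) = lg_one _.
Proof.
by apply: (@lg_mulI _ _ _ (ii (lg_one _))); rewrite -pd_iM !lg_mulg1.
Qed.

Lemma pd_iV p : ii (lg_inv p) = lg_inv (ii p).
Proof. by apply: (@lg_mulI _ _ _ (ii p)); rewrite -pd_iM !lg_mulgV pd_i1. Qed.

Lemma pd_exp_one_param Z :
  exists2 c, one_param c (Z *m in_1 gr) & c 1 = ii (pd_exp D Z).
Proof. exact: is_exp_one_param (pd_expE D Z). Qed.

(** In [G], the product of the subgroups of [Z] and [W] has velocity [Z + W], since [g_1] is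
    abelian; uniqueness identifies it with that of [Z + W], and injectivity of [pd_i] returns to
    [P]. *)
Lemma pd_expD Z W : pd_exp D (Z + W) = lg_mul (pd_exp D Z) (pd_exp D W).
Proof.
apply: pd_i_inj; rewrite pd_iM.
have [c1 h1 <-] := pd_exp_one_param Z; have [c2 h2 <-] := pd_exp_one_param W.
have [c3 + <-] := pd_exp_one_param (Z + W); rewrite mulmxDl => h3.
exact: (one_param_uniq h3 (one_param_mul h1 h2 (br_11 D Z W))).
Qed.

Lemma pd_exp0 : pd_exp D 0 = lg_one _.
Proof.
by apply: (@lg_mulI _ _ _ (pd_exp D 0)); rewrite -pd_expD addr0 lg_mulg1.
Qed.

Lemma Ad_expN Z V : Ad (ii (lg_inv (pd_exp D Z))) V =
  V - br (Z *m in_1 gr) V + 2^-1 *: br (Z *m in_1 gr) (br (Z *m in_1 gr) V).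
Proof.
rewrite pd_iV; have [c hc <-] := pd_exp_one_param Z.
rewrite -(one_paramN 1 hc) (Ad_one_param2 _ hc (br1_cubed D Z V)).
by rewrite scaleN1r sqrrN expr1n mul1r.
Qed.

(** By uniqueness and rescaling, [pd_exp] along the line [t *: W] is the one-parameter subgroup of
    [W], whose velocity is prescribed. *)
Lemma mderiv_exp0 W :
  mderiv ii (lg_one (pd_P D)) (mderiv (pd_exp D) 0 W) = W *m in_1 gr.
Proof.
have okP : forall p, chart_ok p := @lg_chart_ok _ _ (pd_P D).
have okG : forall p, chart_ok p := @lg_chart_ok _ _ (pd_G D).
have hi : has_mderiv ii (pd_exp D 0) (mderiv ii (lg_one (pd_P D))).
  by rewrite pd_exp0; exact: smooth_has_mderiv (okP _) (okG _) pd_i_smooth.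
have he := smooth_has_mderiv (vspace_chart_ok 0) (okP _) pd_exp_smooth.
have hie := has_mderiv_comp (vspace_chart_ok _) (okP _) he hi.
have hl := (has_mderiv_vspace _ _ (0 : R)).2 (is_diff_scalev W 0).
have hie' : has_mderiv (ii \o pd_exp D) (0 *: W)
    (mderiv ii (lg_one (pd_P D)) \o mderiv (pd_exp D) 0) by rewrite scale0r.
have h1 := has_mderiv_comp (vspace_chart_ok _) (vspace_chart_ok _) hl hie'.
have [c hc c1] := pd_exp_one_param W.
have E : ((ii \o pd_exp D) \o (fun t : R => t *: W)) =1 c.
  move=> t /=; have [c' hc' <-] := pd_exp_one_param (t *: W).
  rewrite -scalemxAl in hc'.
  by rewrite (one_param_uniq hc' (one_param_scale t hc)) mulr1.
have := has_mderiv_uniq h1 hc.2 E 1.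
by rewrite /= !scale1r.
Qed.

End Exp.

(** * Charts of the cotangent bundle *)

Section CotangentCharts.
Variables (R : realType) (n : nat) (M : charted 'rV[R]_n).
Hypothesis hM : is_manifold M.
Implicit Types (x p : M).

Let ok : forall p, chart_ok p := manifold_chart_ok hM.

Lemma transition_diff x p : cdom (chart_at x) p ->
  is_diff (cmap (chart_at x) p) (cmap (chart_at p) \o cinv (chart_at x))
    ('d (cmap (chart_at p) \o cinv (chart_at x)) (cmap (chart_at x) p)).
Proof.
move=> xp; have [_ _ mc _ mK _ _ _] := mfd_chart hM x.
apply/differentiableP; have [/= h _] := mfd_transition hM x p 1%N.
by apply: h; split; [exact: mc | rewrite /= mK //; exact: mfd_center].
Qed.

(** [cot_chart] applies [invmx] to this matrix, which inverts only units. The two transition maps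
    compose to the identity near the point, so the chain rule gives a one-sided inverse, enough for
    a square matrix. *)
Lemma cot_jac_unit x p : cdom (chart_at x) p -> cot_jac x p \in unitmx.
Proof.
move=> xp; have [od oc mc id_ mK iK cm ci] := mfd_chart hM x.
pose J' := 'd (cmap (chart_at x) \o cinv (chart_at p)) (cmap (chart_at p) p).
have dJ' : is_diff (cmap (chart_at p) p)
    (cmap (chart_at x) \o cinv (chart_at p)) J'.
  apply/differentiableP; have [/= h _] := mfd_transition hM p x 1%N.
  by apply: h; split; [exact: ok_cod | rewrite /= ok_cinv].
have dJ : is_diff
    ((cmap (chart_at x) \o cinv (chart_at p)) (cmap (chart_at p) p))
    (cmap (chart_at p) \o cinv (chart_at x))
    ('d (cmap (chart_at p) \o cinv (chart_at x)) (cmap (chart_at x) p)).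
  have e1 : (cmap (chart_at x) \o cinv (chart_at p)) (cmap (chart_at p) p) =
    cmap (chart_at x) p.
    exact: (congr1 (cmap (chart_at x)) (ok_cinv (ok p))).
  by rewrite e1; exact: transition_diff.
have h : \forall e \near cmap (chart_at p) p,
    e = ((cmap (chart_at p) \o cinv (chart_at x)) \o
         (cmap (chart_at x) \o cinv (chart_at p))) e.
  have n1 : \forall e \near cmap (chart_at p) p,
      cdom (chart_at x) (cinv (chart_at p) e).
    apply: (ok_cont (ok p)); rewrite ok_cinv //.
    by apply: open_nbhs_nbhs.
  by apply: filterS2 n1 (ok_invK (ok p)) => e e1 e2 /=; rewrite mK.
have E := is_diff_uniq (is_diff_near_eq h (is_diff_id _)) (is_diff_comp dJ' dJ)
  (fun _ => erefl).
have JJ : lin1_mx J' *m cot_jac x p = 1%:M.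
  apply/row_matrixP => i; rewrite !rowE mulmx1 mulmxA /cot_jac !mul_rV_lin1.
  by rewrite [RHS]E.
by have [] := mulmx1_unit JJ.
Qed.

Lemma cot_jac_id x : cot_jac x x = 1%:M.
Proof.
have h : \forall e \near cmap (chart_at x) x, e = (cmap (chart_at x) \o cinv
  (chart_at x)) e.
  by apply: filterS (ok_invK (ok x)) => e /= ->.
have [_ E] := is_diff_near_eq h (is_diff_id _).
by apply/row_matrixP => i; rewrite !rowE mulmx1 /cot_jac mul_rV_lin1 E.
Qed.

Lemma cot_open_cdom x : cot_open [set s : cotangent_type M | cdom (chart_at x)
  s.1].
Proof.
move=> t z [/= zc _] cz; have [od oc mc id_ mK iK cm ci] := mfd_chart hM t.1.
have h : \forall e \near z.1, cdom (chart_at x) (cinv (chart_at t.1) e).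
  apply: (ci _ zc); apply: open_nbhs_nbhs; split=> //.
  exact: chart_open_dom (mfd_chart hM x).
exact: (@cvg_fst _ _ (nbhs z.1) (nbhs z.2) _ _ h).
Qed.

Lemma cotangent_chart_ok (al : cotangent M) : chart_ok al.
Proof.
have [od oc mc id_ mK iK cm ci] := mfd_chart hM al.1.
have c1 := mfd_center hM al.1.
split.
- by apply: open_nbhs_nbhs; split; [exact: cot_open_cdom | exact: c1].
- by split=> //=; exact: mc.
- case=> q a /= xq; rewrite mK // mulmxA mulVmx ?mul1mx //.
  exact: cot_jac_unit.
(* Continuity of the inverse chart is built into the definition of [cot_open]. *)
- move=> W; rewrite nbhsE /= => -[V [oV Vq] VW].
  have zc : ccod (cot_chart al) (cmap (chart_at al) al) by split=> //=;
    exact: mc.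
  have h := oV al _ zc Vq.
  apply: (@filterS _ (nbhs (cmap (chart_at al) al)) _ _ _ _ h).
  by move=> e /VW.
- have n1 : \forall e \near cmap (chart_at al.1) al.1, ccod (chart_at al.1) e.
    by apply: open_nbhs_nbhs; split=> //; exact: mc.
  exists (ccod (chart_at al.1), setT); first by split=> //; exact: filterT.
  move=> [e a] [/= ec _]; rewrite iK // mulmxA mulmxV ?mul1mx //.
  by apply: cot_jac_unit; exact: id_.
Qed.

Lemma mderiv_cot_proj (al : cotangent M) X :
  mderiv (@cot_proj R n M) al X = X.1.
Proof.
have h : \forall e \near cmap (chart_at al) al,
    e.1 = (cmap (chart_at (cot_proj al)) \o @cot_proj R n M
           \o cinv (chart_at al)) e.
  by apply: filterS (ok_invK (cotangent_chart_ok al)) => -[e a] /= [-> _].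
have [_] := is_diff_near_eq h (is_diff_fst _).
by move/(congr1 (@^~ X)).
Qed.

End CotangentCharts.

(** * The Cartan connection along sigma(y) exp(Z) *)

Lemma surjective_rV_section (R : realType) (p q : nat)
    (f : 'rV[R]_p -> 'rV[R]_q) :
  (forall w, exists v, f v = w) ->
  exists S : 'M[R]_(q, p), forall i, f (row i S) = delta_mx 0 i.
Proof.
move=> f_surj; have [g gE] := choice (fun i : 'I_q => f_surj (delta_mx 0 i)).
by exists (\matrix_i g i) => i; rewrite rowK gE.
Qed.

(** * Principal bundle projections are surjective submersions *)

Section Bundle.
Variables (R : realType) (E F : normedModType R) (d : nat) (H : lieGroup R d).
Variables (T : charted E) (X : charted F) (act : T -> H -> T) (pi : T -> X).
Hypotheses (hb : principal_bundle act pi).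
Hypotheses (okT : forall u : T, chart_ok u) (okX : forall x : X, chart_ok x).

Lemma bundle_proj_surj x : exists u, pi u = x.
Proof.
have [U [tau [triv [[_ Ux] _ _ _ h]]]] := pb_trivial hb x.
by exists (triv (x, lg_one H)); have [] := h x (lg_one H) Ux.
Qed.

(** The local section [x |-> triv (x, tau u)] passes through [u]; its tangent map is a right inverse
    of that of [pi]. *)
Lemma bundle_submersion u v : exists V, mderiv pi u V = v.
Proof.
have [U [tau [triv [[oU Ux] [_ ts] _ tK h]]]] := pb_trivial hb (pi u).
pose z : prod_charted X H := (pi u, tau u).
have zok : chart_ok z.
  by apply: prod_chart_ok; [exact: okX | exact: lg_chart_ok].
have td := smooth_on_has_mderiv (M := prod_charted X H)
  (U := [set xh | U xh.1]) zok (okT _) Ux ts.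
have sd := has_mderiv_comp (okX _) zok
  (has_mderiv_pair (has_mderiv_id (okX (pi u)))
    (has_mderiv_cst (tau u) (pi u))) td.
have pd : has_mderiv pi (triv z) (mderiv pi u).
  have -> : triv z = u by exact: tK.
  exact: smooth_has_mderiv (okT _) (okX _) (pb_proj_smooth hb).
have psd := has_mderiv_comp (okX (pi u)) (okT (triv z)) sd pd.
have psn : {near pi u, pi \o (triv \o (fun x => (id x, cst (tau u) x))) =1 id}.
  have nU : \forall x \near pi u, U x by apply: open_nbhs_nbhs.
  by apply: filterS nU => x Ux' /=; have [] := h x (tau u) Ux'.
have E0 := has_mderiv_uniq (has_mderiv_near_eq (okX _) psn psd)
  (has_mderiv_id (okX _)) (fun=> erefl).
by eexists; exact: (E0 v).
Qed.

End Bundle.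

(** * The components of [theta] at [u exp(Z)] *)

Section Flow.
Variables (R : realType) (N n m k : nat) (D : parabolicData R N n m k).
Variables (M : charted 'rV[R]_n) (S : cartanGeometry D M).
Local Notation gr := (pd_gr D).
Local Notation br := (lie_br (pd_G D)).
Local Notation calG := (cg_T S).
Implicit Types (Z W : 'rV[R]_k).

Let okG : forall u : calG, chart_ok u := manifold_chart_ok (cg_mfd S).
Let okP : forall p : pd_P D, chart_ok p := @lg_chart_ok _ _ (pd_P D).

Definition act_diff (u : calG) (p : pd_P D) :
    {linear ('rV[R]_N * 'rV[R]_(m + k))%type -> 'rV[R]_N} :=
  mderiv (M := prod_charted calG (pd_P D)) (N := calG)
    (fun uh => cg_act uh.1 uh.2) (u, p).

Lemma has_mderiv_act (E : normedModType R) (Q : charted E) (f : Q -> calG)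
    (g : Q -> pd_P D) y df dg :
  chart_ok y -> has_mderiv f y df -> has_mderiv g y dg ->
  has_mderiv (fun y => cg_act (f y) (g y)) y
             (fun v => act_diff (f y) (g y) (df v, dg v)).
Proof.
move=> yok fd gd.
have ok2 : chart_ok ((f y, g y) : prod_charted calG (pd_P D))
  by exact: prod_chart_ok.
have ad := smooth_has_mderiv ok2 (okG _) (pb_act_smooth (cg_bundle S)).
exact: has_mderiv_comp yok ok2 (has_mderiv_pair fd gd) ad.
Qed.

(* Since exp (Z + s) = exp Z exp s, moving Z produces a fundamental vector field
   at u exp Z, on which theta is known. *)
Lemma theta_act_diff u Z V W :
  cg_theta (cg_act u (pd_exp D Z))
    (act_diff u (pd_exp D Z) (V, mderiv (pd_exp D) Z W)) =
  Ad (pd_i (lg_inv (pd_exp D Z))) (cg_theta u V) + W *m in_1 gr.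
Proof.
set p := pd_exp D Z; set u' := cg_act u p.
have th_lin := cg_linear (c := S).
have eh := smooth_has_mderiv (vspace_chart_ok Z) (okP _)
  (@pd_exp_smooth _ _ _ _ _ D).
have e1 : act_diff u p (V, 0) = mderiv (fun w : calG => cg_act w p) u V.
  have h := has_mderiv_act (okG u) (has_mderiv_id (okG u)) (has_mderiv_cst p u).
  by have /(congr1 (@^~ V)) := has_mderivE h.
have e2 : act_diff u p (0, mderiv (pd_exp D) Z W) =
    mderiv (cg_act u') (lg_one (pd_P D)) (mderiv (pd_exp D) 0 W).
  have h1 := has_mderiv_act (vspace_chart_ok Z)
    (has_mderiv_cst u (Z : vspace_charted _)) eh.
  have hs := (has_mderiv_vspace _ _ Z).2 (is_diff_subr Z Z).
  have h0 := smooth_has_mderiv (vspace_chart_ok (0 : 'rV[R]_k)) (okP _)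
    (@pd_exp_smooth _ _ _ _ _ D).
  have h0' : has_mderiv (pd_exp D) (Z - Z) (mderiv (pd_exp D) 0)
    by rewrite subrr.
  have h2 := has_mderiv_comp (vspace_chart_ok _) (vspace_chart_ok _) hs h0'.
  have hu : has_mderiv (cg_act u') ((pd_exp D \o (fun z => z - Z)) Z)
      (mderiv (cg_act u') (lg_one (pd_P D))).
    rewrite /= subrr pd_exp0.
    have h3 := has_mderiv_act (okP (lg_one _))
      (has_mderiv_cst u' (lg_one (pd_P D)))
      (has_mderiv_id (okP (lg_one _))).
    by move: (h3) => /has_mderivE ->.
  have h4 := has_mderiv_comp (vspace_chart_ok _) (okP _) h2 hu.
  have E : (fun z => cg_act (cst u z) (pd_exp D z)) =1
      cg_act u' \o (pd_exp D \o (fun z => z - Z)).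
    move=> z; rewrite /u' /p /= -(pb_actM (cg_bundle S)) -pd_expD.
    by rewrite addrC subrK.
  exact: (has_mderiv_uniq h1 h4 E W).
have -> : act_diff u p (V, mderiv (pd_exp D) Z W) =
    1 *: mderiv (fun w : calG => cg_act w p) u V +
    mderiv (cg_act u') (lg_one (pd_P D)) (mderiv (pd_exp D) 0 W).
  rewrite -e1 -e2 scale1r -linearD; congr (act_diff _ _ _).
  by rewrite -[RHS]/(_, _) /= addr0 add0r.
by rewrite th_lin scale1r cg_equiv cg_fund mderiv_exp0.
Qed.

(** Brackets with [Z] never land in degree -1, so that component is unchanged. In degree 1 the
    linear term contributes the bracket of [Z] with the degree 0 part, and the quadratic term the
    double bracket with the degree -1 part. *)
Lemma theta_flow u Z V W :
  let v := act_diff u (pd_exp D Z) (V, mderiv (pd_exp D) Z W) in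
  let u' := cg_act u (pd_exp D Z) in
  theta_m1 u' v = theta_m1 u V /\
  psiB D (theta_1 u' v) = psiB D W + psiB D (theta_1 u V)
    + rho_dual D (theta_0 u V) (psiB D Z)
    + 2^-1 *: psiB D (triple_br D (theta_m1 u V) Z Z).
Proof.
move=> v u'; have [[i1 i2 i3] [[j1 j2 j3 j4] [l1 l2]]] := gr_ids D.
rewrite /theta_m1 /theta_1 /theta_0.
set t := cg_theta u V; set X := t *m pr_m1 gr; set A := t *m pr_0 gr.
have [A' EA'] := br_1m1 D Z X; have [W' EW'] := br_10 D Z A.
have [W'' EW''] := br_10 D Z A'.
have brE : br (Z *m in_1 gr) t = A' *m in_0 gr + W' *m in_1 gr.
  by rewrite [t in LHS](gr_dec D) !brDr br_11 addr0 EA' EW'.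
have br2E : br (Z *m in_1 gr) (br (Z *m in_1 gr) t) = W'' *m in_1 gr.
  by rewrite brE brDr EW'' br_11 addr0.
have thE : cg_theta u' v = t - (A' *m in_0 gr + W' *m in_1 gr) +
    2^-1 *: (W'' *m in_1 gr) + W *m in_1 gr.
  transitivity (Ad (pd_i (lg_inv (pd_exp D Z))) t + W *m in_1 gr).
    exact: theta_act_diff.
  congr (_ + _); transitivity (t - br (Z *m in_1 gr) t +
      2^-1 *: br (Z *m in_1 gr) (br (Z *m in_1 gr) t)); first exact: Ad_expN.
  by rewrite br2E brE.
have psiD a b : psiB D (a + b) = psiB D a + psiB D b.
  by have := psiB_linear D 1 a b; rewrite !scale1r.
have psi0 : psiB D 0 = 0 by apply: (addrI (psiB D 0)); rewrite -psiD !addr0.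
have psiZ a b : psiB D (a *: b) = a *: psiB D b.
  by have := psiB_linear D a b 0; rewrite psi0 !addr0.
have pW' : psiB D W' = - rho_dual D A (psiB D Z).
  by rewrite -psiB_br_10 EW' -mulmxA i3 mulmx1.
have pW'' : psiB D W'' = psiB D (triple_br D X Z Z).
  by rewrite -psiB_br_11m1 EA' EW'' -mulmxA i3 mulmx1.
rewrite thE; split.
  rewrite !mulmxDl mulNmx mulmxDl -scalemxAl.
  by rewrite -!mulmxA j3 l1 !mulmx0 !addr0 oppr0 scaler0 !addr0.
rewrite !mulmxDl mulNmx mulmxDl -scalemxAl -!mulmxA i3 j4 !mulmx1 mulmx0 add0r.
rewrite !psiD psiZ -scaleN1r psiZ scaleN1r pW' pW'' opprK.
by rewrite addrC !addrA.
Qed.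

End Flow.

(** * Comparison of the tensor fields *)

Section Main.
Variables (R : realType) (N n m k : nat).
Variables (D : parabolicData R N n m k).
Variables (M : charted 'rV[R]_n) (hM : is_manifold M).
Variables (S : cartanGeometry D M) (S0 : g0Structure S).
Variables (sigma : s0_T S0 -> cg_T S) (hsigma : weyl_structure sigma).
Local Notation gr := (pd_gr D).
Local Notation calG := (cg_T S).
Local Notation calG0 := (s0_T S0).
Local Notation omega := (@s0_omega _ _ _ _ _ _ _ _ S0).
Local Notation pi0 := (@s0_pi _ _ _ _ _ _ _ _ S0).

Let okM : forall x : M, chart_ok x := manifold_chart_ok hM.
Let okG : forall u : calG, chart_ok u := manifold_chart_ok (cg_mfd S).
Let okG0 : forall y : calG0, chart_ok y := manifold_chart_ok (s0_mfd S0).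

Lemma has_mderiv_sigma y : has_mderiv sigma y (mderiv sigma y).
Proof. by have [sm _ _] := hsigma; exact: smooth_has_mderiv. Qed.

(** Apply the descent property at [sigma y] to the image of [v]: the quotient map undoes [sigma].
    Linearity of [omega], which the type [form1] does not include, is inherited from [theta] this
    way. *)
Lemma omega_sigma y v : omega y v = theta_m1 (sigma y) (mderiv sigma y v).
Proof.
have [_ qs _] := hsigma.
have qd : has_mderiv (s0_q S0) (sigma y) (mderiv (s0_q S0) (sigma y)).
  by apply: smooth_has_mderiv => //; exact: s0_q_smooth.
have h := has_mderiv_comp (okG0 y) (okG _) (has_mderiv_sigma y) qd.
have E := has_mderiv_uniq h (has_mderiv_id (okG0 y)) qs.
by rewrite -(s0_omegaE S0) qs -[X in omega y X]E.
Qed.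

Lemma omega_linear y : linear (omega y).
Proof.
move=> a u v; rewrite !omega_sigma /theta_m1 linearP (cg_linear (c := S)).
by rewrite mulmxDl scalemxAl.
Qed.

Lemma omega_surj y X : exists v, omega y v = X.
Proof.
have [_ qs _] := hsigma; have [th' _ thK] := cg_bij (c := S) (sigma y).
exists (mderiv (s0_q S0) (sigma y) (th' (X *m in_m1 gr))).
have [[i1 _ _] _] := gr_ids D.
have := s0_omegaE S0 (sigma y) (th' (X *m in_m1 gr)); rewrite qs => ->.
by rewrite /theta_m1 thK -mulmxA i1 mulmx1.
Qed.

(** * The map onto the cotangent bundle is a surjective submersion *)

Section Identification.
Variables (cls : prod_charted calG0 (vspace_charted 'cV[R]_n) -> cotangent M).
Hypothesis (hcls : cotangent_identification cls).

Let okC y xi :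
  chart_ok ((y, xi) : prod_charted calG0 (vspace_charted 'cV[R]_n)).
Proof. by apply: prod_chart_ok; [exact: okG0 | exact: vspace_chart_ok]. Qed.

Lemma cls_proj y xi : (cls (y, xi)).1 = pi0 y.
Proof. by have [_ h] := hcls; have [] := h y xi. Qed.

Lemma cls_pairing y xi v :
  pairing (mderiv pi0 y v) (covec (cls (y, xi))) = pairing (omega y v) xi.
Proof. by have [_ h] := hcls; have [_ ->] := h y xi. Qed.

(* Both T pi0 and omega are onto at y, and the defining property of cls says
   that [omega y v = mderiv pi0 y v *m T]; hence T is invertible. *)
Lemma covec_cls y : exists2 T : 'M[R]_n, T \in unitmx &
  forall xi, covec (cls (y, xi)) = T *m xi.
Proof.
have dpi_surj := bundle_submersion (s0_bundle S0) okG0 okM y.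
have [S1 S1E] := surjective_rV_section dpi_surj.
have [S2 S2E] := surjective_rV_section (omega_surj y).
pose om : {linear 'rV[R]_(n + m) -> 'rV[R]_n} :=
  HB.pack (omega y) (GRing.isLinear.Build _ _ _ _ _ (omega_linear y)).
have omE v : v *m lin1_mx om = omega y v by rewrite mul_rV_lin1.
pose T := S1 *m lin1_mx om.
have covE xi : covec (cls (y, xi)) = T *m xi.
  apply/colP => i; have := cls_pairing y xi (row i S1).
  by rewrite S1E -omE -row_mul /pairing -rowE -row_mul !mxE.
have dpiT v : mderiv pi0 y v *m T = omega y v.
  apply/rowP => i.
  have := cls_pairing y (delta_mx i 0) v; rewrite covE /pairing mulmxA.
  by rewrite -!colE !mxE.
exists T => //.
pose dp := S2 *m lin1_mx (mderiv pi0 y).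
have TT : dp *m T = 1%:M.
  apply/row_matrixP => i; rewrite !rowE mulmx1 mulmxA /dp mulmxA -rowE.
  by rewrite mul_rV_lin1 dpiT S2E.
by have [] := mulmx1_unit TT.
Qed.

Lemma has_mderiv_cls y xi : has_mderiv cls (y, xi) (mderiv cls (y, xi)).
Proof.
have [sm _] := hcls; apply: smooth_has_mderiv => //.
exact: cotangent_chart_ok.
Qed.

Lemma mderiv_cls_fst y xi v w : (mderiv cls (y, xi) (v, w)).1 = mderiv pi0 y v.
Proof.
have [_ cd] := has_mderiv_cls y xi.
have h1 := is_diff_comp cd (is_diff_fst _).
have pd : has_mderiv pi0 ((y, xi) : calG0 * _).1 (mderiv pi0 y).
  by apply: smooth_has_mderiv => //; exact: pb_proj_smooth (s0_bundle S0).
have fstd := has_mderiv_fst (p := (y, xi) : prod_charted calG0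
  (vspace_charted 'cV[R]_n)) (okG0 y).
have [_ h2] := has_mderiv_comp (okC y xi) (okG0 y) fstd pd.
pose z : prod_charted calG0 (vspace_charted 'cV[R]_n) := (y, xi).
suff E : (fst \o (cmap (chart_at (cls (y, xi))) \o cls \o cinv (chart_at z))) =1
   (cmap (chart_at (pi0 y)) \o (pi0 \o fst) \o cinv (chart_at z)).
  exact: (is_diff_uniq h1 h2 E (v, w)).
move=> [e a] /=; rewrite cls_proj; congr (cmap _ _); exact: cls_proj.
Qed.

Lemma cls_surj al : exists y xi, al = cls (y, xi).
Proof.
case: al => x a; have [y yx] := bundle_proj_surj (s0_bundle S0) x.
have [T Tu TE] := covec_cls y.
exists y, (invmx T *m a); rewrite [RHS]surjective_pairing cls_proj yx.
by rewrite -[(cls _).2]/(covec _) TE mulmxA mulmxV // mul1mx.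
Qed.

(** Along the fibre the base point stays at the centre [pi0 y] of its chart, where [cot_jac] is the
    identity, so the local expression is [T] itself. *)
Lemma mderiv_cls_snd y xi (T : 'M[R]_n) :
  (forall xi, covec (cls (y, xi)) = T *m xi) ->
  forall w, mderiv cls (y, xi) (0, w) = (0, T *m w).
Proof.
move=> TE w; have [_ cd] := has_mderiv_cls y xi.
have i1 : is_diff xi (fun x => (cmap (chart_at y) y, x)) (fun w => (0, w)).
  exact: is_diff_pair (is_diff_cst _ _) (is_diff_id xi).
have h1 := is_diff_comp i1 cd.
have h2 : is_diff xi
    (fun x : 'cV[R]_n => (cmap (chart_at (pi0 y)) (pi0 y), T *m x))
    (fun w => (0 : 'rV[R]_n, T *m w)).
  apply: is_diff_pair (is_diff_cst _ _) _.
  by apply: is_diff_linear_mx => a u v; rewrite mulmxDr scalemxAr.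
pose z : prod_charted calG0 (vspace_charted 'cV[R]_n) := (y, xi).
suff E : (cmap (chart_at (cls (y, xi))) \o cls \o cinv (chart_at z))
   \o (fun x => (cmap (chart_at y) y, x)) =1
     (fun x => (cmap (chart_at (pi0 y)) (pi0 y), T *m x)).
  exact: (is_diff_uniq h1 h2 E w).
move=> x /=; rewrite (ok_cinv (okG0 y)) !cls_proj (cot_jac_id hM) mul1mx.
by rewrite -[(cls _).2]/(covec _) TE.
Qed.

Lemma mderiv_cls_surj y xi X : exists v w, mderiv cls (y, xi) (v, w) = X.
Proof.
have [T Tu TE] := covec_cls y.
have [v vE] := bundle_submersion (s0_bundle S0) okG0 okM y X.1.
(* The vector [v] realizes the base component but brings along the fibre component [b]; a vertical
   vector supplies the remainder through the invertible [T]. *)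
pose b := (mderiv cls (y, xi) (v, 0)).2.
exists v, (invmx T *m (X.2 - b)).
have -> : (v, invmx T *m (X.2 - b)) = (v, 0) + (0, invmx T *m (X.2 - b)).
  by rewrite -[RHS]/(_, _) /= addr0 add0r.
rewrite linearD (mderiv_cls_snd xi TE) mulmxA mulmxV // mul1mx.
rewrite [X in X + _]surjective_pairing mderiv_cls_fst vE -/b.
by rewrite -[LHS]/(_, _) /= addr0 addrC subrK -surjective_pairing.
Qed.

(** * The pullback of [eta] to the cotangent bundle *)

Section Quotient.
Variables (A : charted 'rV[R]_(n + k)) (qA : calG -> A)
  (hA : is_quotient_G0 qA).
Variables (phi : cotangent M -> A) (hphi : is_weyl_diffeo sigma cls qA phi).

Definition flow (yZ : prod_charted calG0 (vspace_charted 'rV[R]_k)) : calG :=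
  cg_act (sigma yZ.1) (pd_exp D yZ.2).

(** [phi] is prescribed on the points [cls (y, psiB D Z)], so the identity between [phi] after [cls]
    and [qA] after [flow] is differentiated on the product of [G_0] and [g_1]. *)
Lemma mderiv_phi_cls y Z v W :
  mderiv phi (cls (y, psiB D Z)) (mderiv cls (y, psiB D Z) (v, psiB D W)) =
  mderiv qA (flow (y, Z)) (act_diff (sigma y) (pd_exp D Z)
     (mderiv sigma y v, mderiv (pd_exp D) Z W)).
Proof.
have [hA1 hA2] := hA; have okA (a : A) := manifold_chart_ok hA1 a.
have [[phis _] phiE] := hphi.
pose z : prod_charted calG0 (vspace_charted 'rV[R]_k) := (y, Z).
have zok : chart_ok z.
  by apply: prod_chart_ok; [exact: okG0 | exact: vspace_chart_ok].
have fstd := has_mderiv_fst (p := z) (okG0 y).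
have sndd := has_mderiv_snd (p := z) (vspace_chart_ok Z).
have psid : has_mderiv (M := vspace_charted _) (N := vspace_charted _)
    (psiB D) z.2 (psiB D).
  by apply/has_mderiv_vspace/is_diff_linear_mx; exact: psiB_linear.
have d1 := has_mderiv_pair fstd
  (has_mderiv_comp zok (vspace_chart_ok _) sndd psid).
have d2 := has_mderiv_comp zok (okC _ _) d1 (has_mderiv_cls y (psiB D Z)).
have phid := smooth_has_mderiv (cotangent_chart_ok hM (cls (y, psiB D Z)))
  (okA _) phis.
have d3 := has_mderiv_comp zok (cotangent_chart_ok hM _) d2 phid.
have sd := has_mderiv_comp zok (okG0 _) fstd (has_mderiv_sigma y).
have ed : has_mderiv (pd_exp D) z.2 (mderiv (pd_exp D) Z).
  exact: smooth_has_mderiv (vspace_chart_ok _) (lg_chart_ok _)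
    (@pd_exp_smooth _ _ _ _ _ D).
have d4 := has_mderiv_act zok sd
  (has_mderiv_comp zok (vspace_chart_ok _) sndd ed).
have qd : has_mderiv qA (flow z) (mderiv qA (flow z)).
  exact: smooth_has_mderiv (okG _) (okA _) (pb_proj_smooth hA2).
have d5 := has_mderiv_comp zok (okG _) d4 qd.
have E :
    phi \o (cls \o (fun x : prod_charted calG0 (vspace_charted 'rV[R]_k) =>
      (x.1, (psiB D \o snd) x))) =1
    qA \o (fun x : prod_charted calG0 (vspace_charted 'rV[R]_k) =>
      cg_act ((sigma \o fst) x) ((pd_exp D \o snd) x)).
  by move=> [y' Z'] /=; exact: phiE.
exact: (has_mderiv_uniq d3 d5 E (v, W)).
Qed.

Variables (eta : tensor02 A) (heta : represents_eta qA eta).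

Lemma pullback_eta y Z v W v' W' :
  pullback phi eta (cls (y, psiB D Z)) (mderiv cls (y, psiB D Z) (v, psiB D W))
    (mderiv cls (y, psiB D Z) (v', psiB D W')) =
  pairing (omega y v') (psiB D W + psiB D (theta_1 (sigma y) (mderiv sigma y v))
    + rho_dual D (weyl_connection sigma y v) (psiB D Z)
    + 2^-1 *: psiB D (triple_br D (omega y v) Z Z)).
Proof.
have [_ phiE] := hphi.
rewrite /pullback !mderiv_phi_cls phiE -/(flow (y, Z)).
have := heta (flow (y, Z))
  (act_diff (sigma y) (pd_exp D Z) (mderiv sigma y v, mderiv (pd_exp D) Z W))
  (act_diff (sigma y) (pd_exp D Z)
    (mderiv sigma y v', mderiv (pd_exp D) Z W')).
rewrite /pullback => ->.
have [_ h1] := theta_flow (sigma y) Z (mderiv sigma y v) W.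
have [h2 _] := theta_flow (sigma y) Z (mderiv sigma y v') W'.
by rewrite h1 h2 !omega_sigma.
Qed.

End Quotient.
End Identification.
End Main.

Theorem theorem3p3 (R : realType) (N n m k : nat)
    (D : parabolicData R N n m k)
    (M : charted 'rV[R]_n) (hM : is_manifold M)
    (S : cartanGeometry D M) (htf : torsion_free S) (hnormal : normal S)
    (S0 : g0Structure S)
    (cls : prod_charted (s0_T S0) (vspace_charted 'cV[R]_n) -> cotangent M)
    (hcls : cotangent_identification cls)
    (A : charted 'rV[R]_(n + k)) (qA : cg_T S -> A) (hA : is_quotient_G0 qA)
    (eta : tensor02 A) (heta : represents_eta qA eta)
    (sigma : s0_T S0 -> cg_T S) (hsigma : weyl_structure sigma)
    (rho : tensor02 M) (hrho : is_rho_tensor sigma rho)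
    (phi : cotangent M -> A) (hphi : is_weyl_diffeo sigma cls qA phi)
    (zeta : tensor02 (cotangent M))
    (hzeta : represents_zeta cls (weyl_connection sigma) zeta)
    (curly : forall x : M, 'rV[R]_n -> 'cV[R]_n -> 'cV[R]_n -> 'cV[R]_n)
    (hcurly : is_curly cls curly) :
  let h := Sym eta in
  let h_PW := Sym zeta in
  let nu := @cot_proj R n M in
  forall (al : cotangent M) (X Y : 'rV[R]_n * 'cV[R]_n),
    pullback phi h al X Y =
    h_PW al X Y - pullback nu (Sym rho) al X Y + q_tensor curly al X Y.
Proof.
move=> h h_PW nu al X Y.
(* The tensors and [curly] are characterized only through [cls] or [pi0]. Hence [al], [X] and [Y]
   are first lifted along [cls], and the fibre components along the bijection [psiB]. *)
have [psi' _ psiK] := pd_psi_bij D.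
have psiS xi : exists Z, psiB D Z = xi by exists (psi' xi); exact: psiK.
have [y [xi al_E]] := cls_surj hM hsigma hcls al.
have [Z Z_E] := psiS xi.
have [v [w X_E]] := mderiv_cls_surj hM hsigma hcls y xi X.
have [v' [w' Y_E]] := mderiv_cls_surj hM hsigma hcls y xi Y.
have [W W_E] := psiS w; have [W' W'_E] := psiS w'.
subst al X Y xi w w'.
have etaE := pullback_eta hM hsigma hcls hA hphi heta y Z.
have zetaE a b : zeta (cls (y, psiB D Z)) (mderiv cls (y, psiB D Z) a)
  (mderiv cls (y, psiB D Z) b) = _ := hzeta (y, psiB D Z) a b.
have nuE a b : mderiv nu (cls (y, psiB D Z)) (mderiv cls (y, psiB D Z) (a, b)) =
    mderiv (@s0_pi _ _ _ _ _ _ _ _ S0) y a.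
  by rewrite /nu (mderiv_cot_proj hM) (mderiv_cls_fst hM hcls).
have nu_al : nu (cls (y, psiB D Z)) = s0_pi y := cls_proj hcls y (psiB D Z).
have rhoE a b c d : pullback nu rho (cls (y, psiB D Z))
    (mderiv cls (y, psiB D Z) (a, b)) (mderiv cls (y, psiB D Z) (c, d)) =
    pairing (s0_omega y c) (rho_form sigma y a).
  by rewrite /pullback !nuE nu_al; exact: hrho.
have qE a b c d : q_tensor curly (cls (y, psiB D Z))
    (mderiv cls (y, psiB D Z) (a, b)) (mderiv cls (y, psiB D Z) (c, d)) =
    pairing (s0_omega y c) (2^-1 *: psiB D (triple_br D (s0_omega y a) Z Z)).
  rewrite /q_tensor -/nu nu_al !nuE (hcurly y a Z Z) !pairingZ.
  by congr (_ * _); exact: (cls_pairing hcls).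
have symE (E F : normedModType R) (P : charted E) (Q : charted F) (f : P -> Q)
    (b : tensor02 Q) p a c :
    pullback f (Sym b) p a c =
    2^-1 * (pullback f b p a c + pullback f b p c a) by [].
rewrite qE /h /h_PW !symE !etaE !rhoE /Sym !zetaE /zeta_form /rho_form /=.
rewrite !pairingD !pairingN !pairingZ.
rewrite (pairing_triple_sym D (s0_omega y v') (s0_omega y v) Z).
by field.
Qed.
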